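(* Let $m\ge 1$, $n_1<n_2$ and $N$ be integers, and let $E=\{x_n:\,1\le n\le N\}\subset[n_1,n_2]$ be a sequence consisting of distinct points. Then $E$ is a linear sampling sequence for $|W_m|^2_{[n_1,n_2]}$ if and only if all of the following hold: \begin{align*} \# E &\ge (m+1)(n_2-n_1)+m, \\ \# (E\cap [n_1, i)) &\ge (m+1)(i-n_1) \quad\text{for all integers } n_1< i \le n_2, \\ \# (E\cap (i, n_2]) &\ge (m+1)(n_2-i) \quad\text{for all integers } n_1\le i < n_2, \\ \# (E\cap(i,j)) &\ge (m+1)(j-i)-m \quad\text{for all integers } n_1\le i<j\le n_2. \end{align*} When these conditions are satisfied, there exist functions $S_n$, $1\le n\le N$, such that $$|f(x)|^2=\sum_{n=1}^N|f(x_n)|^2S_n(x),\qquad \forall x\in[n_1,n_2],\ f\in W_m.$$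
   Context: $\#E$ denotes the cardinality of $E$. For an integer $m\ge1$, $\varphi_m=\chi_{[0,1]}*\cdots*\chi_{[0,1]}$ ($m+1$ factors) is the cardinal B-spline of degree $m$, and $W_m=\{\sum_{n\in\mathbb Z}c_n\varphi_m(\cdot-n):\ c_n\in\mathbb C\}$ (arbitrary complex coefficients; the sum is locally finite). $|W_m|^2_{[a,b]}$ denotes the set of restrictions to $[a,b]$ of the functions $|f|^2$, $f\in W_m$. For a set $H$ of functions on $[a,b]$ (not necessarily a linear space), a finite sequence $E=\{x_n:1\le n\le N\}\subset[a,b]$ is called a linear sampling sequence for $H$ if there exist functions $S_1,\dots,S_N$ on $[a,b]$ such that $h(x)=\sum_{n=1}^N h(x_n)S_n(x)$ for all $x\in[a,b]$ and all $h\in H$. *)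

(* Defs.v *)
From HB Require Import structures.
From mathcomp Require Import all_boot all_order all_algebra finmap.
From mathcomp Require Import all_classical all_reals all_analysis.
From mathcomp Require Import complex.

Set Implicit Arguments.
Unset Strict Implicit.
Unset Printing Implicit Defensive.

Import Order.TTheory GRing.Theory Num.Theory.

Local Open Scope classical_set_scope.
Local Open Scope complex_scope.
Local Open Scope ring_scope.

Definition convolution (R : realType) (f g : R -> R) (x : R) : R :=
  \int[lebesgue_measure]_(t in [set: R]) (f (x - t) * g t).

(* [m + 1] factors, so [bspline 0] is the indicator function of [0, 1]. *)
Fixpoint bspline (R : realType) (m : nat) : R -> R :=
  if m is m'.+1 then convolution (@bspline R m') \1_`[0, 1] else \1_`[0, 1].

(* The sum over [int] is a finite-support sum: at a given [x] only finitely many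
   terms are nonzero, because [bspline R m] vanishes outside [0, m + 1]. *)
Definition spline_space (R : realType) (m : nat) : set (R -> R[i]) :=
  [set f | exists c : int -> R[i], forall x : R,
    f x = \sum_(n \in [set: int]) (c n * (bspline m (x - n%:~R))%:C)].

(* A function on [a, b] is represented by a total function, and the restriction
   to [a, b] by its extension by 0. *)
Definition sqnorm_restrictions (R : realType) (W : set (R -> R[i])) (a b : R) :
    set (R -> R[i]) :=
  [set patch (fun=> 0) `[a, b] (fun x => `|f x| ^+ 2) | f in W].

Definition linear_sampling_sequence (R : realType) (a b : R)
    (H : set (R -> R[i])) (N : nat) (x : 'I_N -> R) : Prop :=
  (forall n : 'I_N, x n \in `[a, b]) /\
  exists S : 'I_N -> R -> R[i],
    forall h, H h -> forall t : R, t \in `[a, b] ->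
      h t = \sum_(n < N) h (x n) * S n t.

(* [fset_set] is meaningful here because [range x] is finite. *)
Definition card_in (R : realType) (N : nat) (x : 'I_N -> R) (A : set R) : nat :=
  #|` fset_set (range x `&` A)|.

Definition sampling_conditions (R : realType) (m : nat) (n1 n2 : int) (N : nat)
    (x : 'I_N -> R) : Prop :=
  [/\ m.+1%:Z * (n2 - n1) + m%:Z <= (card_in x setT)%:Z,
      forall i : int, n1 < i -> i <= n2 ->
        m.+1%:Z * (i - n1) <= (card_in x `[n1%:~R, i%:~R[)%:Z,
      forall i : int, n1 <= i -> i < n2 ->
        m.+1%:Z * (n2 - i) <= (card_in x `]i%:~R, n2%:~R])%:Z
    & forall i j : int, n1 <= i -> i < j -> j <= n2 ->
        m.+1%:Z * (j - i) - m%:Z <= (card_in x `]i%:~R, j%:~R[)%:Z].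

(* Main.v *)
Require Import Defs.
From HB Require Import structures.
From mathcomp Require Import all_boot all_order all_algebra finmap.
From mathcomp Require Import all_classical all_reals all_analysis.
From mathcomp Require Import complex.
From mathcomp Require Import zify ring lra.

(** Write [M = n2 - n1].  A reconstruction formula that holds on a set of
    functions holds on its linear span, so only the span of the squared moduli
    on [n1, n2] matters.  There, by [real_spline_truncpow], the space W_m is
    spanned by the truncated powers (x - k)_+^m with [k] an integer: a B-spline
    is an iterated difference of them, and the difference can be undone on a
    half-line.  Products of two such truncated powers span all piecewise
    polynomials of degree at most [2 m], with knots at the integers and
    smoothness C^(m-1): polynomials of degree at most [2 m] are sums of products
    of polynomials of degree at most [m], and a jump at [k], divisible by
    (x - k)^m, is a product of (x - k)_+^m with a polynomial of degree at most
    [m].  This space of splines has dimension (m + 1) M + m.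

    Hence sampling on a set [E] is possible exactly when a spline of this space
    that vanishes on [E] is zero, which is called [determined] below.  One
    direction is [sampling_determined]; the other, [determined_sampling], is
    linear algebra: a value is a combination of the samples as soon as every
    linear relation among the samples of the generators is a relation among the
    values.

    The splines that vanish outside a run of unit intervals, from the [i]-th to
    the [j]-th knot, have to vanish to order [m] at those of the two knots that
    are interior.  The dimension of the space they form drops by [m] for each of
    the two ends where this is imposed, and the counting conditions say that the
    samples in the run are at least as many as this dimension.  They are
    necessary because otherwise a homogeneous linear system has more unknowns
    than equations ([determined_interlaced]).  They are sufficient because the
    zeros of a spline whose pieces on the run are all nonzero are fewer than the
    dimension ([spline_zero_bound], applied in [interlaced_determined] to a
    maximal run of nonzero pieces): [m - 1] applications of Rolle's theorem lead
    to a continuous piecewise polynomial of degree [m + 1], which has at most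
    [m + 1] zeros per piece, and a zero of order [m] at an end of the run yields
    one extra zero at each of these applications. *)

Set Implicit Arguments.
Unset Strict Implicit.
Unset Printing Implicit Defensive.

Import Order.TTheory GRing.Theory Num.Theory.
Import numFieldNormedType.Exports.

Local Open Scope classical_set_scope.
Local Open Scope complex_scope.
Local Open Scope ring_scope.

(** * Separated zeros and Rolle's theorem *)

(** Zeros that are told apart by a point where [g] does not vanish.  Mere
    distinctness would not do: even if no piece of a spline vanishes, a piece of
    one of its derivatives may vanish identically, and has infinitely many
    zeros. *)
Definition separated (R : realType) (g : R -> R) (y : nat -> R) (n : nat) :=
  (forall k, (k < n)%N -> g (y k) = 0) /\
  (forall k, (k.+1 < n)%N ->
     exists z, [/\ y k < z, z < y k.+1 & g z != 0]).

Lemma separated_lt (R : realType) (g : R -> R) y n k l :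
  separated g y n -> (k < l)%N -> (l < n)%N -> y k < y l.
Proof.
move=> [_ sep]; elim: l => // l IH; rewrite ltnS leq_eqVlt => /orP[/eqP->|kl] ln.
  by have [z [yz zy _]] := sep _ ln; exact: lt_trans zy.
have [z [yz zy _]] := sep _ ln.
exact: lt_trans (IH kl (ltnW ln)) (lt_trans yz zy).
Qed.

Lemma separated_le (R : realType) (g : R -> R) y n k l :
  separated g y n -> (k <= l)%N -> (l < n)%N -> y k <= y l.
Proof.
move=> sep; rewrite leq_eqVlt => /orP[/eqP-> //|kl] ln.
exact/ltW/(separated_lt sep).
Qed.

Lemma separated_widen (R : realType) (g : R -> R) y n n' :
  (n' <= n)%N -> separated g y n -> separated g y n'.
Proof.
move=> nn' [z0 sep]; split=> k kn; first exact/z0/(leq_trans kn).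
exact/sep/(leq_trans kn).
Qed.

Lemma separated_in_poly (R : realType) (p : {poly R}) (g : R -> R) d b c y n k0 :
  (0 < d)%N -> (size p <= d.+1)%N ->
  (forall x, b <= x <= c -> g x = p.[x]) ->
  separated g y n -> (k0 <= n)%N ->
  (forall k, (k0 <= k < n)%N -> b <= y k <= c) ->
  if p == 0 then (n - k0 <= 1)%N else (n - k0 <= d)%N.
Proof.
move=> d0 sp gp sep k0n yin; case: ifP => [/eqP p0|/negbT p0].
  rewrite leqNgt; apply/negP => k2.
  have k1n : (k0.+1 < n)%N by lia.
  have [z [yz zy /negP[]]] := sep.2 _ k1n.
  have /andP[b1 _] := yin k0 ltac:(lia).
  have /andP[_ b2] := yin k0.+1 ltac:(lia).
  by rewrite gp ?p0 ?horner0 // (le_trans b1 (ltW yz)) (le_trans (ltW zy) b2).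
have := @max_poly_roots _ p (map y (iota k0 (n - k0))) p0.
rewrite size_map size_iota => H; rewrite -ltnS; apply: leq_trans sp; apply: H.
  apply/allP => _ /mapP[k kin ->]; rewrite mem_iota in kin.
  rewrite rootE -gp; last by apply: yin; lia.
  by rewrite sep.1 //; lia.
rewrite map_inj_in_uniq ?iota_uniq // => k l; rewrite !mem_iota => kin lin ykl.
apply/eqP; case: ltngtP => // kl.
  by have := separated_lt sep kl ltac:(lia); rewrite ykl ltxx.
by have := separated_lt sep kl ltac:(lia); rewrite ykl ltxx.
Qed.

Lemma monotone_threshold (P : pred nat) n :
  (forall k l, (k <= l)%N -> (l < n)%N -> P l -> P k) ->
  exists2 t, (t <= n)%N & forall k, (k < n)%N -> P k = (k < t)%N.
Proof.
elim: n => [|n IH] mono; first by exists 0%N.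
have [|t tn tP] := IH; first by move=> k l kl ln; apply: mono => //; lia.
case: (boolP (P n)) => Pn.
  exists n.+1 => // k kn; rewrite kn.
  by rewrite ltnS in kn; apply: (mono k n).
exists t; first by lia.
move=> k; rewrite ltnS leq_eqVlt => /orP[/eqP->|/tP//].
by rewrite (negbTE Pn) ltnNge tn.
Qed.

(** Continuity is expressed by letting the polynomials agree with [g] on closed
    intervals.  A piece that vanishes identically contains at most one of the
    separated zeros, and that zero can be charged to the neighbouring piece. *)
Lemma piecewise_poly_zeros (R : realType) (d M : nat) (a : R) (g : R -> R) y n :
  (0 < d)%N -> (0 < M)%N ->
  (forall k, (k < M)%N -> exists2 p : {poly R}, (size p <= d.+1)%N &
     forall x, a + k%:R <= x <= a + k.+1%:R -> g x = p.[x]) ->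
  separated g y n -> (forall k, (k < n)%N -> a <= y k <= a + M%:R) ->
  (n <= M * d)%N.
Proof.
move=> d0; elim: M y n => // -[_|M IH] y n _ gp sep yin.
  have [p sp gpE] := gp 0%N isT; rewrite addr0 in gpE.
  have := separated_in_poly d0 sp gpE sep (leq0n n) yin.
  by case: ifP; lia.
have {}IH := IH _ _ isT (fun k kM => gp k (ltnW kM)).
have [p sp gpE] := gp M.+1 (ltnSn _).
set b := a + M.+1%:R in gpE IH.
have [|t tn tP] := @monotone_threshold (fun k => y k <= b) n.
  by move=> k l kl ln; apply/le_trans/(separated_le sep).
have lo k : (k < t)%N -> a <= y k <= b.
  move=> kt; have kn := leq_trans kt tn.
  by rewrite tP // kt andbT; have /andP[] := yin _ kn.
have hi k : (t <= k < n)%N -> b <= y k <= a + M.+2%:R.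
  move=> /andP[tk kn]; have /andP[_ ->] := yin _ kn; rewrite andbT.
  by rewrite ltW // ltNge tP // -leqNgt.
have := separated_in_poly d0 sp gpE sep tn hi.
have lot := IH _ _ (separated_widen tn sep) lo.
case: ifP => [/eqP p0 nt|_ nt]; last by rewrite mulSn; lia.
have [->|ntE] : n = t \/ n = t.+1 by lia.
  by rewrite mulSn; lia.
(* The last piece vanishes identically and carries the single zero [y t]; that
   zero can be moved to the left end [b] of the piece. *)
pose y' k := if k == t then b else y k.
have y'E k : (k < t)%N -> y' k = y k.
  by move=> kt; rewrite /y' ltn_eqF.
have gb : g b = 0 by rewrite gpE ?p0 ?horner0 // lexx /= lerD2l ler_nat.
suff : (n <= M.+1 * d)%N by rewrite [(M.+2 * d)%N]mulSn; lia.
apply: (IH y'); last first.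
  move=> k; rewrite ntE ltnS leq_eqVlt => /orP[/eqP->|kt].
    by rewrite /y' eqxx lexx lerDl ler0n.
  by rewrite y'E //; exact: lo.
split=> k; rewrite ntE ltnS.
  rewrite leq_eqVlt => /orP[/eqP->|kt]; first by rewrite /y' eqxx.
  by rewrite y'E // sep.1 // (leq_trans kt).
rewrite leq_eqVlt => /orP[/eqP kt|kt]; last first.
  rewrite !y'E ?(ltnW kt) //; exact/sep.2/(leq_trans kt).
have [|z [yz zy gz]] := sep.2 k; first by rewrite ntE kt.
exists z; split=> //; first by rewrite y'E // -kt.
rewrite /y' kt eqxx ltNge; apply: contra gz => bz.
have /andP[_ h2] := hi k.+1 ltac:(lia).
by rewrite gpE ?p0 ?horner0 // bz (le_trans (ltW zy) h2).
Qed.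

Lemma derive_continuous (R : realType) (g g' : R -> R) (A : set R) :
  (forall x : R, is_derive x 1 g (g' x)) -> {within A, continuous g}.
Proof.
move=> dg; apply: continuous_subspaceT => x.
by apply: differentiable_continuous; apply/derivable1_diffP; have := dg x; case.
Qed.

(** The point is found where the square of [g] is largest between the two zeros,
    so [g] does not vanish there: this is what keeps the zeros of the derivative
    separated. *)
Lemma rolle_nonzero (R : realType) (g g' : R -> R) (b c z : R) :
  (forall x : R, is_derive x 1 g (g' x)) -> g b = 0 -> g c = 0 ->
  b < z -> z < c -> g z != 0 ->
  exists x, [/\ b < x, x < c, g x != 0 & g' x = 0].
Proof.
move=> dg gb gc bz zc gz.
have dh (x : R) : is_derive x 1 (fun x => g x * g x) (g x * g' x + g x * g' x).
  by have dgx := dg x; apply: is_deriveM.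
have bc : b < c := lt_trans bz zc.
have [x xin xmax] := EVT_max (ltW bc) (@derive_continuous _ _ _ `[b, c] dh).
have gx : g x != 0.
  have zin : z \in `[b, c] by rewrite in_itv /= !ltW.
  apply/eqP => gx0; have /= := xmax z zin.
  by rewrite gx0 mul0r leNgt -expr2 lt_def sqr_ge0 andbT expf_eq0 /= gz.
have [bx xc] : b < x /\ x < c.
  move: xin; rewrite in_itv /= !le_eqVlt => /andP[/orP[/eqP bE|bx] /orP[/eqP cE|xc]] //.
  - by move: gx; rewrite -bE gb eqxx.
  - by move: gx; rewrite -bE gb eqxx.
  - by move: gx; rewrite cE gc eqxx.
exists x; split=> //.
have := @derive1_at_max _ (fun x => g x * g x) b c x (ltW bc).
case.
- by move=> t _; have := dh t; case.
- by rewrite in_itv /= bx xc.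
- move=> t; rewrite in_itv /= => /andP[bt tc]; apply: xmax.
  by rewrite in_itv /= !ltW.
move=> _; have [_ ->] := dh x => /eqP; rewrite -mulr2n mulrn_eq0 /= mulf_eq0.
by rewrite (negbTE gx) => /eqP.
Qed.

Lemma derive_nonzero_between (R : realType) (g g' : R -> R) (b c : R) :
  (forall x : R, is_derive x 1 g (g' x)) -> b < c -> g b != g c ->
  exists z, [/\ b < z, z < c & g' z != 0].
Proof.
move=> dg bc gbc.
have [x] := MVT bc (fun (x : R) _ => dg x) (@derive_continuous _ _ _ `[b, c] dg).
rewrite in_itv /= => /andP[bx xc] E; exists x; split => //.
apply/eqP => g0; move: E; rewrite g0 mul0r => /eqP.
by rewrite subr_eq0 eq_sym (negbTE gbc).
Qed.

Lemma rolle_separated (R : realType) (g g' : R -> R) y n :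
  (forall x : R, is_derive x 1 g (g' x)) -> separated g y n.+1 ->
  exists y', separated g' y' n /\
    forall k, (k < n)%N -> [/\ y k < y' k, y' k < y k.+1 & g (y' k) != 0].
Proof.
move=> dg sep.
have ex k : exists x, (k < n)%N -> [/\ y k < x, x < y k.+1, g x != 0 & g' x = 0].
  case: (ltnP k n) => kn; last by exists 0.
  have [z [yz zy gz]] := sep.2 k kn.
  have [x xP] := rolle_nonzero dg (sep.1 k (ltnW kn)) (sep.1 k.+1 kn) yz zy gz.
  by exists x.
have [y' y'P] := choice ex.
exists y'; split; last by move=> k /y'P[].
split=> k kn; first by have [] := y'P _ kn.
have [_ h1 h2 _] := y'P k (ltnW kn); have [h3 _ _ _] := y'P _ kn.
have [|z [z1 z2 z3]] := @derive_nonzero_between _ _ _ (y' k) (y k.+1) dg h1.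
  by rewrite sep.1 // (ltn_trans kn).
by exists z; split => //; exact: lt_trans h3.
Qed.

Lemma separated_cons (R : realType) (g : R -> R) a y n :
  g a = 0 -> separated g y n ->
  ((0 < n)%N -> exists z, [/\ a < z, z < y 0%N & g z != 0]) ->
  separated g (fun k => if k is k'.+1 then y k' else a) n.+1.
Proof.
move=> ga [z0 sep] sepa; split=> -[|k] //= kn; [exact: z0|exact: sep].
Qed.

Lemma separated_rcons (R : realType) (g : R -> R) b y n :
  g b = 0 -> separated g y n ->
  ((0 < n)%N -> exists z, [/\ y n.-1 < z, z < b & g z != 0]) ->
  separated g (fun k => if (k < n)%N then y k else b) n.+1.
Proof.
move=> gb [z0 sep] sepb; split=> k; rewrite ltnS.
  by case: ltnP => // kn _; exact: z0.
move=> kn; rewrite kn; case: ltnP => kn'; first exact: sep.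
have -> : k = n.-1 by lia.
by apply: sepb; lia.
Qed.

(** A common zero of [g] and [g'] at an end of the interval is not used up by
    Rolle's theorem: it gives one more zero of [g'], at that same end.  The flags
    [L] and [U] tell whether this happens at the lower and at the upper end. *)
Lemma rolle_flagged (R : realType) (g g' : R -> R) (L U : bool) a b y n :
  a < b -> (forall x : R, is_derive x 1 g (g' x)) ->
  separated g y n.+1 -> (forall k, (k <= n)%N -> a <= y k <= b) ->
  (L -> y 0%N = a /\ g' a = 0) -> (U -> y n = b /\ g' b = 0) ->
  exists y', let n' := (n + L + U)%N in
    [/\ separated g' y' n', forall k, (k < n')%N -> a <= y' k <= b,
        L -> y' 0%N = a & U -> y' n'.-1 = b].
Proof.
move=> ab dg sep yin La Ub.
have [y1 [sep1 y1P]] := rolle_separated dg sep.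
have y1in k : (k < n)%N -> a <= y1 k <= b.
  move=> kn; have [h1 h2 _] := y1P k kn.
  have /andP[h3 _] := yin k (ltnW kn); have /andP[_ h4] := yin k.+1 kn.
  by rewrite (le_trans h3 (ltW h1)) (le_trans (ltW h2) h4).
have [y2 [sep2 y2in y20 y2E]] : exists y2,
    [/\ separated g' y2 (n + L)%N, forall k, (k < n + L)%N -> a <= y2 k <= b,
        L -> y2 0%N = a & (0 < n)%N -> y2 (n + L).-1 = y1 n.-1].
  case: L La => [/(_ isT)[ya g'a]|_]; last by exists y1; rewrite addn0.
  exists (fun k => if k is k'.+1 then y1 k' else a); rewrite addn1.
  split => //; last by case: (n).
    apply: separated_cons => // n0; have [h1 _ h3] := y1P _ n0.
    apply: (derive_nonzero_between dg); first by rewrite -ya.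
    by rewrite -ya sep.1 // eq_sym.
  by move=> [_|k]; [rewrite lexx ltW|exact: y1in].
case: U Ub => [/(_ isT)[yb g'b]|_]; last by exists y2; rewrite addn0.
exists (fun k => if (k < n + L)%N then y2 k else b) => /=; rewrite addn1; split.
- apply: separated_rcons => // nL; case: (posnP n) => n0.
    have [|ya _] := La; first by move: nL; rewrite n0 lt0b.
    by move: ab; rewrite -yb n0 ya ltxx.
  rewrite y2E //; have [|_ h2 h3] := y1P n.-1; first by rewrite prednK.
  apply: (derive_nonzero_between dg); first by rewrite -yb; rewrite prednK in h2.
  by rewrite -yb sep.1.
- move=> k _; case: ltnP => [|_]; first exact: y2in.
  by rewrite lexx ltW.
- by move=> LT; rewrite LT addn1 /= y20.
- by rewrite /= ltnn.
Qed.

(** Each of the [s] applications of Rolle's theorem costs one zero and gives back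
    one for each flagged end. *)
Lemma flagged_zero_bound (R : realType) (s d M : nat) (L U : bool) (a : R)
    (G : nat -> R -> R) y n :
  (0 < d)%N -> (0 < M)%N ->
  (forall t, (t < s)%N -> forall x : R, is_derive x 1 (G t) (G t.+1 x)) ->
  (forall k, (k < M)%N -> exists2 p : {poly R}, (size p <= d.+1)%N &
     forall x, a + k%:R <= x <= a + k.+1%:R -> G s x = p.[x]) ->
  (L -> forall t, (t <= s)%N -> G t a = 0) ->
  (U -> forall t, (t <= s)%N -> G t (a + M%:R) = 0) ->
  separated (G 0%N) y n -> (forall k, (k < n)%N -> a <= y k <= a + M%:R) ->
  (L -> y 0%N = a) -> (U -> y n.-1 = a + M%:R) -> (0 < n)%N ->
  (n + s * (L + U) <= M * d + s)%N.
Proof.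
move=> d0 M0; elim: s G y n => [|s IH] G y n dG pG GL GU sep yin yL yU n0.
  by rewrite mul0n !addn0; exact: piecewise_poly_zeros pG sep yin.
have ab : a < a + M%:R by rewrite ltrDl ltr0n.
case: n => // n in sep yin yU n0 *.
have [||y' /= [sep' y'in y'L y'U]] :=
  @rolle_flagged _ (G 0%N) (G 1%N) L U _ _ y n ab (dG 0%N isT) sep yin.
- by move=> LT; split; [exact: yL|exact: GL].
- by move=> UT; split; [exact: yU|exact: GU].
case: (posnP (n + L + U)) => [|n'0]; first by case: (L) (U) => [] []; nia.
have := IH (fun t => G t.+1) y' _ (fun t ts => dG t.+1 ts) pG
  (fun LT t ts => GL LT t.+1 ts) (fun UT t ts => GU UT t.+1 ts) sep' y'in y'L y'U n'0.
by lia.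
Qed.

(** * Piecewise polynomial functions with smooth junctions *)

(** The only one-sided function whose derivative at the junction is computed from
    the definition; every other one below is a product of it with a
    polynomial. *)
Lemma is_derive_sqr_pos (R : realType) (x : R) :
  is_derive x 1 (fun x => Num.max 0 x ^+ 2) (2 * Num.max 0 x).
Proof.
have [x0|x0|<-] := ltgtP 0 x.
- apply: (@near_eq_is_derive _ _ _ (fun x : R => x ^+ 2)).
    near=> y; rewrite max_r // ltW //.
    by near: y; exact: lt_nbhsr.
  by apply: is_derive_eq; rewrite /GRing.scale /= !mulr1 -mulr2n mulr_natl.
- apply: (@near_eq_is_derive _ _ _ (cst 0)).
    near=> y; rewrite max_l ?expr0n //= ltW //.
    by near: y; exact: lt_nbhsl.
  by apply: is_derive_eq; rewrite mulr0.
have cvg0 : (fun h : R => h^-1 *: (Num.max 0 (h *: (1 : R) + 0 : R) ^+ 2 -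
    Num.max 0 (0 : R) ^+ 2 : R)) @ 0^' --> (0 : R).
  apply/cvgrPdist_lt => e e0; near=> h.
  rewrite maxxx expr0n /= subr0 addr0 sub0r normrN /GRing.scale /= mulr1.
  have h0 : h != 0 by near: h; exact: nbhs_dnbhs_neq.
  have he : `|h| < e by near: h; exact: dnbhs0_lt.
  case: (leP 0 h) => hs; last by rewrite expr0n /= mulr0 normr0.
  by rewrite expr2 mulrA mulVf // mul1r.
by apply: DeriveDef; [apply/cvg_ex; exists 0|rewrite mulr0; exact/cvg_lim].
Unshelve. all: by end_near. Qed.

Definition cut_poly (R : realType) (a : R) (Q : {poly R}) (x : R) : R :=
  if a < x then Q.[x] else 0.

Lemma is_derive_cut_poly (R : realType) (a : R) (Q : {poly R}) (x : R) :
  ('X - a%:P) ^+ 2 %| Q ->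
  is_derive x 1 (cut_poly a Q) (cut_poly a Q^`() x).
Proof.
move=> /dvdpP[q ->].
have -> : cut_poly a (q * ('X - a%:P) ^+ 2) =
    fun x : R => q.[x] * (Num.max 0 (x - a) ^+ 2).
  apply/funext => t; rewrite /cut_poly hornerM horner_exp hornerXsubC; case: ltP => ta.
    by rewrite max_r // subr_ge0 ltW.
  by rewrite max_l ?subr_le0 // expr0n /= mulr0.
have d1 : is_derive x 1 (fun x : R => x - a) 1.
  by apply: is_derive_eq; rewrite subr0.
have d2 := @is_derive_sqr_pos R (x - a).
have d3 := @is_derive1_comp _ (fun x : R => Num.max 0 x ^+ 2) (fun x : R => x - a) x _ _ d2 d1.
have d4 := is_deriveM (is_derive_poly q x) d3.
apply: is_derive_eq d4 _.
rewrite /cut_poly /= /GRing.scale /= mulr1 derivM deriv_exp derivXsubC /= mul1r.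
rewrite hornerD !hornerM hornerMn horner_exp hornerXsubC.
case: ltP => xa.
  rewrite max_r ?subr_ge0 1?ltW //.
  by ring.
by rewrite max_l ?subr_le0 //; ring.
Qed.

(** The piecewise polynomial function is written as its first piece plus one-sided
    jumps, rather than by cases, so that it is defined and can be differentiated
    term by term on the whole line. *)
Definition glue (R : realType) (P : nat -> {poly R}) (M : nat) (a x : R) : R :=
  (P 0%N).[x] +
  \sum_(k < M.-1) cut_poly (a + k.+1%:R) (P k.+1 - P k) x.

Lemma glue_piece (R : realType) (P : nat -> {poly R}) M (a x : R) k :
  (forall k, (k.+1 < M)%N -> (P k.+1 - P k).[a + k.+1%:R] = 0) ->
  (k < M)%N -> a + k%:R <= x <= a + k.+1%:R -> glue P M a x = (P k).[x].
Proof.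
move=> PM kM /andP[kx xk]; rewrite /glue.
rewrite -(big_mkord xpredT (fun k => cut_poly (a + k.+1%:R) (P k.+1 - P k) x)).
rewrite (big_cat_nat (n := k)) //=; last by lia.
rewrite [X in _ + (_ + X)]big_nat_cond [X in _ + (_ + X)]big1 ?addr0; last first.
  move=> l /andP[/andP[kl _] _]; rewrite /cut_poly ltNge (le_trans xk) //.
  by rewrite lerD2l ler_nat ltnS.
rewrite (@eq_big_nat _ _ _ _ _ _ (fun l => (P l.+1).[x] - (P l).[x])) => [|l lk].
  by rewrite telescope_sumr // addrC subrK.
rewrite -hornerN -hornerD /cut_poly; case: ltP => // xl.
have -> : x = a + l.+1%:R.
  apply: le_anti; rewrite xl (le_trans _ kx) // lerD2l ler_nat; lia.
by rewrite PM //; lia.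
Qed.

Lemma is_derive_glue (R : realType) (P : nat -> {poly R}) M (a x : R) :
  (forall k, (k.+1 < M)%N -> ('X - (a + k.+1%:R)%:P) ^+ 2 %| P k.+1 - P k) ->
  is_derive x 1 (glue P M a) (glue (fun k => (P k)^`()) M a x).
Proof.
move=> PM.
have -> : glue P M a = horner (P 0%N) +
    \sum_(k < M.-1) cut_poly (a + k.+1%:R) (P k.+1 - P k).
  by apply/funext => t; rewrite /glue fctE fct_sumE.
apply: is_deriveD; apply: is_derive_sum => k.
by rewrite -derivB; apply: is_derive_cut_poly; apply: PM; case: k => k /=; lia.
Qed.

Lemma poly_nonroot_between (R : realType) (p : {poly R}) (b c : R) :
  p != 0 -> b < c -> exists z, [/\ b < z, z < c & p.[z] != 0].
Proof.
move=> p0 bc; apply: contrapT => /forallNP H.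
have cb : 0 < c - b by rewrite subr_gt0.
pose f (i : nat) := b + (c - b) / i.+2%:R.
have fin i : b < f i < c.
  rewrite /f ltrDl divr_gt0 ?ltr0n //= -ltrBrDl ltr_pdivrMr ?ltr0n //.
  by rewrite ltr_pMr // ltr1n.
have := @max_poly_roots _ p (map f (iota 0 (size p))) p0.
rewrite size_map size_iota ltnn => K; suff : false by []; apply: K.
  apply/allP => _ /mapP[i _ ->]; rewrite rootE; apply/negPn/negP => fi.
  by apply: (H (f i)); have /andP[] := fin i.
rewrite map_inj_in_uniq ?iota_uniq // => i j _ _ /addrI /(mulfI (lt0r_neq0 cb)).
by move=> /invr_inj /eqP; rewrite eqr_nat => /eqP[].
Qed.

Lemma dvdp_derivn (R : realType) (a : R) (Q : {poly R}) r t :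
  ('X - a%:P) ^+ r %| Q -> ('X - a%:P) ^+ (r - t) %| Q^`(t).
Proof.
move=> rQ; elim: t => [|t IH]; first by rewrite subn0.
rewrite derivnS subnS; case: (r - t)%N IH => [_|u /dvdpP[q ->]] /=.
  by rewrite expr0 dvd1p.
rewrite derivM deriv_exp derivXsubC mul1r /= mulrnAr; apply: dvdp_add.
  by rewrite dvdp_mull // exprSr dvdp_mulIl.
by rewrite -mulrnAl dvdp_mull.
Qed.

Lemma dvdp_horner0 (R : realType) (a : R) (Q : {poly R}) r :
  (0 < r)%N -> ('X - a%:P) ^+ r %| Q -> Q.[a] = 0.
Proof.
case: r => // r _ rQ; apply/rootP; rewrite -dvdp_XsubCl.
by apply: dvdp_trans rQ; rewrite exprS dvdp_mulIl.
Qed.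

Lemma size_derivn_leq (R : realType) (p : {poly R}) d t :
  (size p <= d)%N -> (size p^`(t) <= d - t)%N.
Proof.
move=> sp; elim: t => [|t IH]; first by rewrite subn0.
rewrite derivnS subnS; apply: leq_trans (size_poly _ _) _.
by move: IH; case: (size _); case: (d - t)%N.
Qed.

(** Smoothness C^(r-1) at a knot is stated as divisibility of the jump by a power
    of a linear factor, which passes to products of splines and, with [r]
    lowered by one, to derivatives. *)
Definition spline_pieces (R : realType) (d r M : nat) (a : R)
    (P : nat -> {poly R}) :=
  (forall k, (k < M)%N -> (size (P k) <= d.+1)%N) /\
  (forall k, (k.+1 < M)%N -> ('X - (a + k.+1%:R)%:P) ^+ r %| P k.+1 - P k).

Lemma glue_pieceE (R : realType) d r M (a : R) P k x :
  (0 < r)%N -> spline_pieces d r M a P ->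
  (k < M)%N -> a + k%:R <= x <= a + k.+1%:R -> glue P M a x = (P k).[x].
Proof.
by move=> r0 [_ sP]; apply: glue_piece => l /sP; exact: dvdp_horner0.
Qed.

Lemma locate_piece (R : realType) M (a x : R) :
  a <= x < a + M%:R ->
  exists2 k, (k < M)%N & a + k%:R <= x < a + k.+1%:R.
Proof.
elim: M => [|M IH] /andP[ax xM]; first by move: xM; rewrite addr0 ltNge ax.
case: (ltP x (a + M%:R)) => h; last by exists M => //; rewrite h.
by have [|k kM kx] := IH; rewrite ?ax //; exists k => //; exact: ltnW.
Qed.

Lemma locate_closed_piece (R : realType) M (a x : R) :
  (0 < M)%N -> a <= x <= a + M%:R ->
  exists2 k, (k < M)%N & a + k%:R <= x <= a + k.+1%:R.
Proof.
move=> M0 /andP[ax]; rewrite le_eqVlt => /orP[/eqP->|xM].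
  by exists M.-1; rewrite ?prednK // lexx andbT lerD2l ler_nat leq_pred.
have [|k kM /andP[k1 k2]] := @locate_piece _ M a x; first by rewrite ax.
by exists k; rewrite // k1 ltW.
Qed.

Lemma glue_nonzero_between (R : realType) d r M (a b c : R) P :
  (0 < r)%N -> spline_pieces d r M a P -> (forall k, (k < M)%N -> P k != 0) ->
  a <= b -> b < c -> c <= a + M%:R ->
  exists z, [/\ b < z, z < c & glue P M a z != 0].
Proof.
move=> r0 sP P0 ab bc cM.
have [|k kM /andP[k1 k2]] := @locate_piece _ M a b.
  by rewrite ab (lt_le_trans bc).
have [|z [z1 z2 z3]] := @poly_nonroot_between _ _ b (Num.min c (a + k.+1%:R)) (P0 _ kM).
  by rewrite lt_min bc.
move: z2; rewrite lt_min => /andP[zc zk].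
by exists z; rewrite (glue_pieceE r0 sP kM) // (le_trans k1 (ltW z1)) ltW.
Qed.

(** Zero count for splines of degree [2 m] and smoothness [m - 1] none of whose
    pieces vanishes: there are fewer zeros than the dimension of the space of
    such splines.  Rolle's theorem is applied [m - 1] times; the derivative so
    reached is continuous with pieces of degree [m + 1], whose roots are counted
    piece by piece. *)
Lemma spline_zero_bound (R : realType) (m M : nat) (L U : bool) (a : R) P
    (E : seq R) :
  (0 < m)%N -> (0 < M)%N ->
  spline_pieces m.*2 m M a P -> (forall k, (k < M)%N -> P k != 0) ->
  (L -> ('X - a%:P) ^+ m %| P 0%N) ->
  (U -> ('X - (a + M%:R)%:P) ^+ m %| P M.-1) ->
  sorted <%R E ->
  (forall e, e \in E -> [/\ a <= e <= a + M%:R, L -> a < e, U -> e < a + M%:R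
     & glue P M a e = 0]) ->
  (size E + m * (L + U) < m.+1 * M + m)%N.
Proof.
move=> m0 M0 sP P0 PL PU sE EP.
have [sz sm] := sP.
pose G t := glue (fun k => (P k)^`(t)) M a.
have sG t : (t < m)%N -> spline_pieces (m.*2 - t) (m - t) M a (fun k => (P k)^`(t)).
  move=> tm; split=> k kM; last by rewrite -derivnB; exact/dvdp_derivn/sm.
  by rewrite -subSn; [exact/size_derivn_leq/sz|lia].
have dG t : (t < m.-1)%N -> forall x : R, is_derive x 1 (G t) (G t.+1 x).
  move=> tm x; rewrite /G; under [X in glue X M a x]eq_fun do rewrite derivnS.
  apply: is_derive_glue => k kM; have [|_ /(_ k kM)] := sG t; first by lia.
  by apply: dvdp_trans; rewrite dvdp_exp2l //; lia.
pose s := (if L then [:: a] else [::]) ++ E ++ (if U then [:: a + M%:R] else [::]).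
have ss : size s = (size E + (L + U))%N.
  by rewrite !size_cat; case: (L); case: (U) => /=; lia.
have aM : a < a + M%:R by rewrite ltrDl ltr0n.
have sin e : e \in s -> (a <= e <= a + M%:R) && (G 0%N e == 0).
  rewrite /s !mem_cat => /or3P[|/EP[-> _ _ eE]|].
  - case: (L) PL => // /(_ isT) PL; rewrite inE => /eqP->.
    rewrite lexx ltW //= /G (glue_pieceE m0 sP M0) ?addr0 ?lexx ?lerDl ?ler01 //.
    exact/eqP/(dvdp_horner0 m0).
  - by rewrite /G eE eqxx.
  - case: (U) PU => // /(_ isT) PU; rewrite inE => /eqP->.
    have M1 : (M.-1 < M)%N by rewrite prednK.
    rewrite lexx ltW //= /G (glue_pieceE m0 sP M1); last first.
      by rewrite prednK // lexx lerD2l ler_nat leq_pred.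
    exact/eqP/(dvdp_horner0 m0).
have sorts : sorted <%R s.
  rewrite /s; have sEU : sorted <%R (E ++ (if U then [:: a + M%:R] else [::])).
    case: (U) EP => EP; last by rewrite cats0.
    rewrite cats1 lt_sorted_pairwise pairwise_rcons -lt_sorted_pairwise sE andbT.
    by apply/allP => e /EP[_ _ /(_ isT)].
  case: (L) EP => EP //=; rewrite path_min_sorted //; apply/allP => e.
  rewrite mem_cat => /orP[/EP[_ /(_ isT)]//|].
  by case: (U) => //; rewrite inE => /eqP->.
have [n0|n0] := posnP (size s).
  by move: n0 ss; case: (L); case: (U) => /= -> ; nia.
have nin k : (k < size s)%N -> (a <= nth 0 s k <= a + M%:R) && (G 0%N (nth 0 s k) == 0).
  by move=> ks; apply/sin/mem_nth.
have := @flagged_zero_bound _ m.-1 m.+1 M L U a G (nth 0 s) (size s) isT M0 dG.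
have -> : (size s + m.-1 * (L + U) = size E + m * (L + U))%N.
  by rewrite ss; case: (m) m0 => // m' _; rewrite mulSn /=; lia.
have -> : (M * m.+1 + m.-1 = (m.+1 * M + m).-1)%N by rewrite mulnC; lia.
move=> H; suff : (size E + m * (L + U) <= (m.+1 * M + m).-1)%N by lia.
apply: H => //.
- move=> k kM; have mm : (m.-1 < m)%N by rewrite prednK.
  have sGm := sG _ mm.
  exists (P k)^`(m.-1); last by move=> x; apply: glue_pieceE sGm kM; lia.
  by apply: leq_trans (sGm.1 k kM) _; lia.
- move=> LT t tm; have tm' : (t < m)%N by lia.
  rewrite /G (glue_pieceE _ (sG t tm') M0) ?subn_gt0 //; last first.
    by rewrite addr0 lexx lerDl ler01.
  by apply: (dvdp_horner0 (r := m - t)); [lia|exact/dvdp_derivn/PL].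
- move=> UT t tm; have tm' : (t < m)%N by lia.
  have M1 : (M.-1 < M)%N by rewrite prednK.
  rewrite /G (glue_pieceE _ (sG t tm') M1) ?subn_gt0 //; last first.
    by rewrite prednK // lexx lerD2l ler_nat leq_pred.
  by apply: (dvdp_horner0 (r := m - t)); [lia|exact/dvdp_derivn/PU].
- split=> k ks; first by have /andP[_ /eqP] := nin k ks.
  have /andP[/andP[h1 _] _] := nin k (ltnW ks).
  have /andP[/andP[_ h2] _] := nin _ ks.
  by apply: (glue_nonzero_between m0 sP) => //; exact: (sortedP 0 sorts).
- by move=> k /nin/andP[].
- by move=> LT; rewrite /s LT.
- move=> UT; rewrite nth_last /s UT catA cats1 last_rcons //.
Qed.

(** * Interlacing with the knots and determination by samples *)

(** The counting conditions, in a form that treats the ends of the interval and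
    the interior knots alike: [L] and [U] tell whether the splines in question
    are required to vanish to order [m] at the lower knot [i] and at the upper
    knot [j]; they may remain free there only at an end of the interval. *)
Definition interlaced (R : realType) (m M : nat) (a : R) (E : seq R) :=
  forall (L U : bool) i j, (i < j <= M)%N -> (i == 0%N) || L -> (j == M) || U ->
  (m.+1 * (j - i) + m <=
   count (fun x : R => (L ==> (a + i%:R < x)%R) && (U ==> (x < a + j%:R)%R)) E +
   m * (L + U))%N.

Definition determined (R : realType) (m M : nat) (a : R) (E : seq R) :=
  forall P, spline_pieces m.*2 m M a P ->
  (forall e, e \in E -> glue P M a e = 0) -> forall k, (k < M)%N -> P k = 0.

Lemma maximal_run (Q : pred nat) M k : (k < M)%N -> Q k ->
  exists i j, [/\ (i <= k < j)%N, (j <= M)%N, forall l, (i <= l < j)%N -> Q l,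
    (0 < i)%N -> ~~ Q i.-1 & (j < M)%N -> ~~ Q j].
Proof.
move=> kM Qk.
have [i [ik iQ iN]] : exists i, [/\ (i <= k)%N, forall l, (i <= l <= k)%N -> Q l
    & (0 < i)%N -> ~~ Q i.-1].
  have ex : exists i, (i <= k)%N && [forall l : 'I_k.+1, (i <= l)%N ==> Q l].
    exists k; rewrite leqnn; apply/forallP => l; apply/implyP => kl.
    by have -> : nat_of_ord l = k by apply/eqP; rewrite eqn_leq kl -ltnS ltn_ord.
  case: (ex_minnP ex) => i /andP[ik /forallP iQ] mini; exists i.
  have iQ' l : (i <= l <= k)%N -> Q l.
    by move=> /andP[il lk]; have := implyP (iQ (Ordinal (lk : l < k.+1)%N)) il.
  split=> // i0; apply/negP => Qi; have := mini i.-1.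
  suff -> : (i.-1 <= k)%N && [forall l : 'I_k.+1, (i.-1 <= l)%N ==> Q l].
    by move=> /(_ isT); lia.
  apply/andP; split; first by lia.
  apply/forallP => l; apply/implyP => il.
  have [<-//|li] := eqVneq i.-1 l.
  by apply: iQ'; have := ltn_ord l; lia.
have [j [jk jM jQ jN]] : exists j, [/\ (k < j)%N, (j <= M)%N,
    forall l, (k <= l < j)%N -> Q l & (j < M)%N -> ~~ Q j].
  have ex : exists j, (k < j <= M)%N && ((j == M) || ~~ Q j).
    by exists M; rewrite kM leqnn eqxx.
  case: (ex_minnP ex) => j /andP[/andP[kj jM] jN] minj; exists j; split=> //.
    move=> l /andP[]; rewrite leq_eqVlt => /orP[/eqP<- //|kl] lj.
    apply/negPn/negP => Ql; have := minj l.
    by rewrite kl Ql orbT andbT (leq_trans (ltnW lj) jM) => /(_ isT); lia.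
  by move=> jM'; move: jN; rewrite ltn_eqF.
exists i, j; split=> //; first by rewrite ik.
move=> l /andP[il lj]; case: (leqP l k) => lk; first by apply: iQ; rewrite il.
by apply: jQ; rewrite lj ltnW.
Qed.

(** On a maximal run of nonvanishing pieces, the zeros given by the counting
    condition are too many for [spline_zero_bound]. *)
Lemma interlaced_determined (R : realType) (m M : nat) (a : R) (E : seq R) :
  (0 < m)%N -> sorted <%R E -> (forall e, e \in E -> a <= e <= a + M%:R) ->
  interlaced m M a E -> determined m M a E.
Proof.
move=> m0 sE Ein lace P sP PE k0 k0M; apply/eqP/negPn/negP => Pk0.
have [i [j [/andP[ik kj] jM Pn0 iN jN]]] := @maximal_run (fun k => P k != 0) M k0 k0M Pk0.
have ij : (i < j)%N by lia.
pose L := (0 < i)%N; pose U := (j < M)%N.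
have := lace L U i j; rewrite ij jM => /(_ isT).
have -> : (i == 0%N) || L by rewrite /L; case: (i).
have -> : (j == M) || U by rewrite /U; case: ltngtP jM.
move=> /(_ isT isT); rewrite leqNgt -size_filter => /negP; apply.
set F := seq.filter _ E; have [sz sm] := sP.
have sPi : spline_pieces m.*2 m (j - i) (a + i%:R) (fun k => P (i + k)%N).
  split=> k kM; first by apply: sz; lia.
  by rewrite -addrA -natrD addnS; apply: sm; lia.
have aj : a + i%:R + (j - i)%:R = a + j%:R by rewrite -addrA -natrD subnKC // ltnW.
apply: (spline_zero_bound (a := a + i%:R) (P := fun k => P (i + k)%N)) => //.
- by rewrite subn_gt0.
- by move=> k kM; apply: Pn0; lia.
- move=> i0; have := sm i.-1; rewrite prednK // (eqP (negPn (iN i0))) subr0 addn0.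
  by apply; lia.
- move=> jM'; have := sm j.-1; rewrite prednK; last by lia.
  move=> /(_ jM'); rewrite (eqP (negPn (jN jM'))) sub0r dvdpNr aj.
  by have -> : (i + (j - i).-1 = j.-1)%N by lia.
- exact: (sorted_filter lt_trans).
move=> e; rewrite mem_filter => /andP[/andP[/implyP Le /implyP Ue] eE].
have /andP[ae eM] := Ein e eE.
have ein : a + i%:R <= e <= a + i%:R + (j - i)%:R.
  rewrite aj; apply/andP; split.
    by case: (posnP i) => [->|/Le/ltW//]; rewrite addr0.
  by case: (ltnP j M) => [/Ue/ltW//|Mj]; have -> : j = M by apply/eqP; rewrite eqn_leq jM.
split=> //; first by rewrite aj.
have [|k kM kin] := locate_closed_piece _ ein; first by rewrite subn_gt0.
have ikM : (i + k < M)%N.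
  by rewrite -ltn_subRL; apply: leq_trans kM _; exact: leq_sub2r.
rewrite (glue_pieceE m0 sPi kM kin) -(glue_pieceE m0 sP ikM) ?PE //.
by rewrite -addnS !natrD !addrA.
Qed.

(** A homogeneous linear system with more unknowns than equations, the unknowns
    being the entries of a matrix. *)
Lemma common_kernel (F : fieldType) (p q : nat) (I : finType)
    (f : I -> 'M[F]_(p, q) -> F) :
  (forall i c u v, f i (c *: u + v) = c * f i u + f i v) ->
  (#|I| < p * q)%N -> exists2 C, C != 0 & forall i, f i C = 0.
Proof.
move=> lin Ipq.
pose A := \matrix_(s < p * q, t < #|I|) f (enum_val t) (vec_mx (delta_mx 0 s)).
have kA : kermx A != 0.
  rewrite -mxrank_eq0 mxrank_ker subn_eq0 -ltnNge.
  exact: leq_ltn_trans (rank_leq_col _) Ipq.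
have [v vA v0] := rowV0Pn kA.
exists (vec_mx v); first by rewrite vec_mx_eq0.
move=> i; have f0 : f i 0 = 0.
  by apply: (addrI (f i 0)); rewrite addr0 -{1}[f i 0]mul1r -lin scale1r addr0.
move/sub_kermxP: vA => /matrixP /(_ 0 (enum_rank i)); rewrite !mxE.
under eq_bigr do rewrite mxE enum_rankK.
move=> <-; rewrite {1}(row_sum_delta v) linear_sum.
elim/big_ind2: _ => // [u1 x1 u2 x2 <- <-|s _].
  by rewrite -{1}[u1]scale1r lin mul1r.
by rewrite linearZ /= -[X in f i X]addr0 lin f0 addr0.
Qed.

Lemma glue_linear (R : realType) M (a x c : R) (P Q : nat -> {poly R}) :
  glue (fun k => c *: P k + Q k) M a x = c * glue P M a x + glue Q M a x.
Proof.
rewrite /glue hornerD hornerZ mulrDr addrACA big_distrr /= -big_split /=.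
congr (_ + _); apply: eq_bigr => k _; rewrite /cut_poly.
case: ifP => _; last by rewrite mulr0 addr0.
by rewrite !(hornerD, hornerN, hornerZ); ring.
Qed.

Lemma dvdp_expXsubC_coef (R : realType) (p : {poly R}) (b : R) m :
  (forall s, (s < m)%N -> (p \Po ('X + b%:P))`_s = 0) -> ('X - b%:P) ^+ m %| p.
Proof.
move=> ps; set q := p \Po ('X + b%:P) in ps.
have -> : p = q \Po ('X - b%:P).
  by rewrite /q -comp_polyA comp_polyD comp_polyX comp_polyC subrK comp_polyXr.
rewrite -[q](poly_take_drop m).
have -> : take_poly m q = 0.
  by apply/polyP => s; rewrite coef_take_poly coef0; case: ifP => // /ps.
by rewrite add0r comp_polyM comp_Xn_poly dvdp_mulIr.
Qed.

(** Counting unknowns against equations: if there are too few samples near some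
    run of unit intervals, the coefficients of the pieces on that run satisfy a
    homogeneous system (smoothness at the knots, vanishing at the samples) with
    more unknowns than equations. *)
Lemma determined_interlaced (R : realType) (m M : nat) (a : R) (E : seq R) :
  (0 < m)%N -> (forall e, e \in E -> a <= e <= a + M%:R) ->
  determined m M a E -> interlaced m M a E.
Proof.
move=> m0 Ein det L U i j /andP[ij jM] iL jU; rewrite leqNgt; apply/negP.
rewrite -size_filter; set F := seq.filter _ E => few.
pose n := (j - i).-1; have nE : (j - i)%N = n.+1 by rewrite prednK // subn_gt0.
pose ai := a + i%:R; pose aj := a + j%:R.
have ajE : ai + n.+1%:R = aj by rewrite /ai /aj -addrA -natrD -nE subnKC // ltnW.
pose pc (C : 'M[R]_(n.+1, m.*2.+1)) k := rVpoly (row (inord k) C).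
have pcL c u v k : pc (c *: u + v) k = c *: pc u k + pc v k.
  by rewrite /pc !linearP.
pose f (t : 'I_n * 'I_m + ('I_(L * m) + 'I_(U * m)) + 'I_(size F)) C : R :=
  match t with
  | inl (inl (k, s)) => ((pc C k.+1 - pc C k) \Po ('X + (ai + k.+1%:R)%:P))`_s
  | inl (inr (inl s)) => (pc C 0%N \Po ('X + ai%:P))`_s
  | inl (inr (inr s)) => (pc C n \Po ('X + aj%:P))`_s
  | inr e => glue (pc C) n.+1 ai (nth 0 F e)
  end.
have coefL (c b : R) (p q : {poly R}) s :
    ((c *: p + q) \Po ('X + b%:P))`_s =
    c * (p \Po ('X + b%:P))`_s + (q \Po ('X + b%:P))`_s.
  by rewrite comp_polyD comp_polyZ coefD coefZ.
have [||C C0 CE] := @common_kernel _ _ _ _ f.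
- move=> [[[k s]|[s|s]]|e] c u v; rewrite /f; last 3 first.
  + by rewrite pcL coefL.
  + by rewrite pcL coefL.
  + by rewrite -glue_linear; congr glue; apply/funext => k; rewrite pcL.
  rewrite -coefL; congr ((_ \Po _)`_s).
  by rewrite !pcL scalerBr opprD addrACA.
- rewrite !card_sum card_prod !card_ord.
  by move: few; rewrite nE; case: (L) (U) => [] []; lia.
have pcM k : (k < n)%N -> ('X - (ai + k.+1%:R)%:P) ^+ m %| pc C k.+1 - pc C k.
  move=> kn; apply: dvdp_expXsubC_coef => s sm.
  exact: (CE (inl (inl (Ordinal kn, Ordinal sm)))).
have pcL0 : L -> ('X - ai%:P) ^+ m %| pc C 0%N.
  move=> LT; apply: dvdp_expXsubC_coef => s sm.
  have sm' : (s < L * m)%N by rewrite LT mul1n.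
  exact: (CE (inl (inr (inl (Ordinal sm'))))).
have pcU0 : U -> ('X - aj%:P) ^+ m %| pc C n.
  move=> UT; apply: dvdp_expXsubC_coef => s sm.
  have sm' : (s < U * m)%N by rewrite UT mul1n.
  exact: (CE (inl (inr (inr (Ordinal sm'))))).
have pcF e : e \in F -> glue (pc C) n.+1 ai e = 0.
  move=> eF; have eF' : (index e F < size F)%N by rewrite index_mem.
  by have := CE (inr (Ordinal eF')); rewrite /f /= nth_index.
have sp : spline_pieces m.*2 m n.+1 ai (pc C).
  by split=> k kM; [exact: size_poly|exact: pcM].
(* Extended by zero outside the run, these pieces still fit together smoothly,
   because an end of the run is flagged unless it is an end of the interval. *)
pose P k := if (i <= k < j)%N then pc C (k - i)%N else 0.
have sP : spline_pieces m.*2 m M a P.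
  split=> k kM; first by rewrite /P; case: ifP => // _; [exact: size_poly|rewrite size_poly0].
  rewrite /P; case: (ltngtP k.+1 i) => ki.
  - by rewrite !ifF ?subr0 //; lia.
  - case: (ltngtP k.+1 j) => kj.
    + rewrite !ifT; try lia; rewrite subSn; last by lia.
      have := pcM (k - i)%N; rewrite /ai -addrA -natrD addnS subnKC; last by lia.
      by apply; lia.
    + by rewrite !ifF ?subr0 //; lia.
    + rewrite andbF andbT ifT; last by lia.
      have -> : (k - i = n)%N by lia.
      rewrite sub0r dvdpNr kj; apply: pcU0.
      by move: jU; rewrite -kj ltn_eqF.
  - rewrite ifT; last by lia.
    rewrite ifF; last by lia.
    rewrite subr0 ki subnn; apply: pcL0.
    by move: iL; rewrite -ki.
have PE e : e \in E -> glue P M a e = 0.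
  move=> eE; have eM := Ein e eE.
  have [|k kM kin] := locate_closed_piece _ eM; first by lia.
  rewrite (glue_pieceE m0 sP kM kin) /P; case: ifP => [/andP[ik kj]|_]; last by rewrite horner0.
  have kin' : ai + (k - i)%:R <= e <= ai + (k - i).+1%:R.
    by rewrite /ai -!addrA -!natrD addnS subnKC.
  have kn : (k - i < n.+1)%N by lia.
  rewrite -(glue_pieceE m0 sp kn kin').
  have /andP[ke ek] := kin.
  have [eF|] := boolP (e \in F); first exact: pcF.
  rewrite mem_filter eE andbT negb_and !negb_imply => /orP[/andP[LT]|/andP[UT]].
    rewrite -leNgt => ei.
    have eE' : e = ai.
      by apply: le_anti; rewrite ei (le_trans _ ke) // lerD2l ler_nat.
    rewrite (glue_pieceE (k := 0%N) m0 sp) //; last by rewrite eE' addr0 lexx lerDl ler0n.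
    by rewrite eE'; apply: dvdp_horner0 (pcL0 LT).
  rewrite -leNgt => je.
  have eE' : e = aj.
    by apply: le_anti; rewrite je andbT (le_trans ek) // lerD2l ler_nat.
  rewrite (glue_pieceE (k := n) m0 sp) //; last by rewrite ajE eE' lexx andbT -ajE lerD2l ler_nat.
  by rewrite eE'; apply: dvdp_horner0 (pcU0 UT).
move/negP: C0; apply; apply/eqP/row_matrixP => k; rewrite row0.
have := det P sP PE (i + k)%N; rewrite /P leq_addr /= addKn /pc inord_val.
have kn := ltn_ord k; rewrite ifT; last by lia.
move=> H; apply: (can_inj rVpolyK); rewrite H ?linear0 //; lia.
Qed.

Definition sample_seq (R : realType) (N : nat) (x : 'I_N -> R) : seq R :=
  sort <=%R [seq x n | n <- enum 'I_N].

Lemma mem_sample_seq (R : realType) (N : nat) (x : 'I_N -> R) e :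
  e \in sample_seq x -> exists n, e = x n.
Proof. by rewrite mem_sort => /mapP[n _ ->]; exists n. Qed.

Lemma sample_in_seq (R : realType) (N : nat) (x : 'I_N -> R) n :
  x n \in sample_seq x.
Proof. by rewrite mem_sort map_f // mem_enum. Qed.

Lemma sample_seq_sorted (R : realType) (N : nat) (x : 'I_N -> R) :
  injective x -> sorted <%R (sample_seq x).
Proof. by move=> xi; rewrite sort_lt_sorted map_inj_uniq ?enum_uniq. Qed.

Lemma card_in_count (R : realType) (N : nat) (x : 'I_N -> R) (A : set R) (b : pred R) :
  injective x -> (forall e, e \in sample_seq x -> b e <-> A e) ->
  card_in x A = count b (sample_seq x).
Proof.
move=> xi bA; rewrite -size_filter /card_in; apply: perm_size.
apply: uniq_perm; first exact: fset_uniq.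
  by rewrite filter_uniq // sort_uniq map_inj_uniq ?enum_uniq.
have fin : finite_set (range x `&` A) by apply: finite_setIl; exact: finite_image.
move=> e; rewrite mem_filter; apply/idP/idP.
  rewrite in_fset_set // inE => -[[n _ <-] Axn].
  by rewrite sample_in_seq andbT; apply/bA => //; exact: sample_in_seq.
move=> /andP[be eE]; rewrite in_fset_set // inE.
split; last exact/bA.
by have [n ->] := mem_sample_seq eE; exists n.
Qed.

(** The four families of conditions are the four choices of the two flags. *)
Lemma interlaced_sampling_conditions (R : realType) (m : nat) (n1 n2 : int)
    (N : nat) (x : 'I_N -> R) (M := `|n2 - n1|%N) :
  n1 < n2 -> injective x -> (forall n, x n \in `[n1%:~R, n2%:~R]) ->
  interlaced m M n1%:~R (sample_seq x) <-> sampling_conditions m n1 n2 x.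
Proof.
move=> n12 xi xin; set a : R := n1%:~R.
have n2E : n2 = n1 + M%:Z by rewrite /M gez0_abs ?subr_ge0 ?ltW // subrKC.
have n2R : n2%:~R = a + M%:R by rewrite n2E intrD.
have ein e : e \in sample_seq x -> (a <= e) && (e <= a + M%:R).
  by move=> /mem_sample_seq[n ->]; have := xin n; rewrite in_itv /= n2R.
have card1 : card_in x setT = size (sample_seq x).
  by rewrite -count_predT; apply: card_in_count.
have card2 k : card_in x `[a, a + k%:R[ = count (fun e : R => e < a + k%:R) (sample_seq x).
  apply: card_in_count => // e /ein /andP[ae _] /=.
  by rewrite in_itv /= ae.
have card3 k : card_in x `]a + k%:R, a + M%:R] = count (fun e : R => a + k%:R < e) (sample_seq x).
  apply: card_in_count => // e /ein /andP[_ eM] /=.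
  by rewrite in_itv /= eM andbT.
have card4 i j : card_in x `]a + i%:R, a + j%:R[ =
    count (fun e : R => (a + i%:R < e) && (e < a + j%:R)) (sample_seq x).
  by apply: card_in_count => // e _ /=; rewrite in_itv.
have intE (i : int) : n1 <= i -> exists k : nat, i = n1 + k%:Z.
  by move=> n1i; exists `|i - n1|%N; rewrite gez0_abs ?subr_ge0 // subrKC.
have subE (k : nat) : n1 + k%:Z - n1 = k%:Z by rewrite addrC addKr.
have subE2 (k l : nat) : n1 + k%:Z - (n1 + l%:Z) = k%:Z - l%:Z by rewrite opprD addrACA subrr add0r.
have M0 : (0 < M)%N by rewrite /M absz_gt0 subr_eq0 gt_eqF.
have leM (k : nat) : (n1 + k%:Z <= n2) = (k <= M)%N by rewrite n2E lerD2l.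
have ltM (k : nat) : (n1 + k%:Z < n2) = (k < M)%N by rewrite n2E ltrD2l.
pose E := sample_seq x.
pose cond := [/\ (m.+1 * M + m <= size E)%N,
  forall k, (0 < k <= M)%N -> (m.+1 * k <= count (fun e : R => (e < a + k%:R)%R) E)%N,
  forall k, (k < M)%N -> (m.+1 * (M - k) <= count (fun e : R => (a + k%:R < e)%R) E)%N
  & forall k l, (k < l <= M)%N ->
    (m.+1 * (l - k) <= count (fun e : R => (a + k%:R < e < a + l%:R)%R) E + m)%N].
transitivity cond.
  split=> [lace|[c1 c2 c3 c4]].
    split.
    - have := lace false false 0%N M.
      by rewrite M0 leqnn !eqxx subn0 muln0 addn0 /= count_predT => /(_ isT isT isT).
    - move=> k k0M; have := lace false true 0%N k k0M isT.
      by rewrite orbT subn0 muln1 leq_add2r => /(_ isT).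
    - move=> k kM; have := lace true false k M.
      rewrite kM leqnn eqxx orbT muln1 leq_add2r /= => /(_ isT isT isT).
      by under eq_count do rewrite andbT.
    - move=> k l kl; have := lace true true k l kl.
      by rewrite !orbT /= muln2 -addnn addnA leq_add2r => /(_ isT isT).
  move=> [] [] i j ijM iL jU; rewrite ?muln0 ?muln1 ?muln2 ?addn0 /=.
  - by rewrite -addnn addnA leq_add2r; exact: c4.
  - move: jU; rewrite orbF => /eqP jM; move: ijM; rewrite jM => /andP[iM _].
    rewrite leq_add2r; under eq_count do rewrite andbT; exact: c3.
  - move: iL; rewrite orbF => /eqP i0; move: ijM; rewrite i0 subn0 leq_add2r.
    exact: c2.
  - move: iL jU; rewrite !orbF => /eqP-> /eqP->; rewrite subn0 count_predT; exact: c1.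
split=> [[c1 c2 c3 c4]|[c1 c2 c3 c4]]; split.
- by rewrite n2E subE card1 -PoszM -PoszD lez_nat.
- move=> i /[dup] /ltW/intE[k ->]; rewrite ltrDl leM ltz_nat => k0 kM.
  by rewrite subE intrD card2 -PoszM lez_nat c2 // k0.
- move=> i /intE[k ->]; rewrite ltM => kM.
  rewrite n2R intrD card3 n2E subE2 subzn ?(ltnW kM) // -PoszM lez_nat; exact: c3.
- move=> i j n1i kj; have [k iE] := intE i n1i.
  have [|l jE] := intE j; first exact: le_trans n1i (ltW kj).
  move: kj; rewrite iE jE leM ltrD2l ltz_nat => kl lM.
  rewrite !intrD card4 subE2 subzn ?(ltnW kl) // lerBlDr -PoszM -PoszD lez_nat.
  by apply: c4; rewrite kl.
- by move: c1; rewrite n2E subE card1 -PoszM -PoszD lez_nat.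
- move=> k /andP[k0 kM]; have := c2 (n1 + k%:Z).
  rewrite ltrDl leM ltz_nat subE intrD card2 -PoszM lez_nat; exact.
- move=> k kM; have := c3 (n1 + k%:Z).
  rewrite lerDl ltM n2R intrD card3 n2E subE2 subzn ?(ltnW kM) // -PoszM lez_nat.
  exact.
- move=> k l /andP[kl lM]; have := c4 (n1 + k%:Z) (n1 + l%:Z).
  rewrite lerDl leM ltrD2l ltz_nat !intrD card4 subE2 subzn ?(ltnW kl) //.
  by rewrite lerBlDr -PoszM -PoszD lez_nat; exact.
Qed.

(** * B-splines as differences of truncated powers *)

Definition truncpow (R : realType) (m : nat) (x : R) : R := Num.max 0 x ^+ m.

Definition backdiff (R : realType) (h : R -> R) (x : R) : R := h x - h (x - 1).

Lemma truncpow_cut_poly (R : realType) m : @truncpow R m.+1 = cut_poly 0 ('X^(m.+1)).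
Proof.
apply/funext => x; rewrite /truncpow /cut_poly hornerXn.
by case: (ltP 0 x) => // _; rewrite expr0n.
Qed.

Lemma is_derive_truncpow (R : realType) m (x : R) :
  is_derive x 1 (truncpow m.+2) (m.+2%:R * truncpow m.+1 x).
Proof.
have -> : m.+2%:R * truncpow m.+1 x = cut_poly 0 ('X^(m.+2))^`() x.
  rewrite truncpow_cut_poly /cut_poly derivXn hornerMn !hornerXn mulr_natl.
  by case: ifP => // _; rewrite mul0rn.
rewrite truncpow_cut_poly; apply: is_derive_cut_poly.
by rewrite subr0 dvdp_exp2l.
Qed.

Lemma is_derive_iter_backdiff (R : realType) (H h : R -> R) j :
  (forall x : R, is_derive x 1 H (h x)) ->
  forall x : R, is_derive x 1 (iter j (@backdiff R) H) (iter j (@backdiff R) h x).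
Proof.
move=> dH; elim: j => //= j IH x.
have d1 : is_derive x 1 (fun x : R => x - 1) 1.
  by apply: is_derive_eq; rewrite subr0.
have d2 := @is_derive1_comp _ (iter j (@backdiff R) H) (fun x : R => x - 1) x _ _ (IH (x - 1)) d1.
have d3 := is_deriveB (IH x) d2.
by apply: is_derive_eq d3 _; rewrite /backdiff /= /GRing.scale /= mulr1.
Qed.

(** Convolution with the indicator function of the unit interval integrates over
    [x - 1, x], so it is the difference of a primitive. *)
Lemma convolution_indicator (R : realType) (H h : R -> R) (x : R) :
  (forall x : R, is_derive x 1 H (h x)) -> continuous h ->
  convolution h \1_`[0, 1] x = backdiff H x.
Proof.
move=> dH ch; rewrite /convolution /Rintegral.
have dF (t : R) : is_derive t 1 (fun t => - H (x - t)) (h (x - t)).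
  have d1 : is_derive t 1 (fun t : R => x - t) (-1).
    by apply: is_derive_eq; rewrite add0r mul1r.
  have d2 := @is_derive1_comp _ H (fun t : R => x - t) t _ _ (dH (x - t)) d1.
  have d3 := is_deriveN d2.
  by apply: is_derive_eq d3 _; rewrite /= /GRing.scale /= mulrN1 opprK.
have cF : continuous (fun t => - H (x - t)).
  move=> t; apply: differentiable_continuous; apply/derivable1_diffP.
  by have := dF t; case.
have chx : continuous (fun t => h (x - t)).
  move=> t; apply: (@continuous_comp _ _ _ (fun t => x - t) h); last exact: ch.
  by apply: continuousB; [exact: cst_continuous|move=> ?].
rewrite (_ : (\int[lebesgue_measure]_(t in setT) _)%E =
  (\int[lebesgue_measure]_(t in `[(0 : R)%R, (1 : R)%R]) (h (x - t)%R)%:E)%E); last first.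
  rewrite [RHS]integral_mkcond; apply: eq_integral => t _.
  by rewrite patchE indicE; case: (t \in _); rewrite ?mulr1 ?mulr0.
rewrite (continuous_FTC2 (F := fun t => - H (x - t))) //.
- by rewrite /= /backdiff subr0; ring.
- exact: continuous_subspaceT.
- split.
  + by move=> t _; have := dF t; case.
  + exact/cvg_at_right_filter/cF.
  + exact/cvg_at_left_filter/cF.
- by move=> t _; rewrite derive1E; have := dF t => -[_ ->].
Qed.

Lemma continuous_iter_backdiff (R : realType) (h : R -> R) j :
  continuous h -> continuous (iter j (@backdiff R) h).
Proof.
move=> ch; elim: j => //= j IH x.
have c1 : {for x, continuous (fun x : R => x - 1)}.
  by apply: continuousB => //; exact: cst_continuous.
exact: (continuousB (IH x) (continuous_comp c1 (IH (x - 1)))).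
Qed.

Lemma iter_backdiffZ (R : realType) (h : R -> R) c j x :
  iter j (@backdiff R) (fun x => c * h x) x = c * iter j (@backdiff R) h x.
Proof.
by elim: j x => //= j IH x; rewrite /backdiff !IH mulrBr.
Qed.

Lemma continuous_truncpow (R : realType) m : continuous (@truncpow R m.+1).
Proof.
move=> x; have c1 : {for x, continuous (fun x : R => Num.max 0 x)}.
  by apply: (@continuous_max _ _ (fun=> 0) id) => //; exact: cst_continuous.
exact: (continuous_comp c1 (@exprn_continuous R m.+1 _)).
Qed.

(** The convolution of two indicator functions is the length of the intersection
    of two unit intervals; the indicator function is not continuous, which puts
    this case out of reach of [convolution_indicator]. *)
Lemma bspline1E (R : realType) (x : R) :
  bspline 1 x = backdiff (backdiff (@truncpow R 1)) x.
Proof.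
rewrite /= /convolution /Rintegral.
pose A : set R := `[Num.max 0 (x - 1), Num.min 1 x]%classic.
rewrite (_ : (\int[lebesgue_measure]_(t in setT) _)%E =
  (\int[lebesgue_measure]_(t in setT) (\1_A t)%:E)%E); last first.
  apply: eq_integral => t _; congr (_%:E); rewrite !indicE -natrM mulnb.
  congr (_%:R); congr nat_of_bool; rewrite /A !mem_setE !in_itv /= ge_max le_min.
  by rewrite subr_ge0 lerBlDr lerBlDl; lra.
rewrite integral_indic //; last exact: measurable_itv.
rewrite setIT; have := lebesgue_measure_itv `[Num.max 0 (x - 1), Num.min 1 x].
rewrite -/A => muA; apply: etrans (congr1 fine muA) _.
rewrite /= lte_fin /backdiff /truncpow !expr1.
case: ifP => h; case: (leP 0 x) h => ?; case: (leP 0 (x - 1)) => ?;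
  case: (leP 0 (x - 1 - 1)) => ?; case: (leP 1 x) => ? /=; lra.
Qed.

Lemma bspline_truncpow (R : realType) m (x : R) :
  bspline m.+1 x = (m.+1)`!%:R^-1 * iter m.+2 (@backdiff R) (truncpow m.+1) x.
Proof.
elim: m x => [|m IH] x; first by rewrite bspline1E invr1 mul1r.
rewrite -[LHS]/(convolution (@bspline R m.+1) \1_`[0, 1] x).
have -> : @bspline R m.+1 = fun x => (m.+1)`!%:R^-1 * iter m.+2 (@backdiff R) (truncpow m.+1) x.
  exact/funext.
have dH (t : R) : is_derive t 1
    (fun x => (m.+2)`!%:R^-1 * iter m.+2 (@backdiff R) (truncpow m.+2) x)
    ((m.+1)`!%:R^-1 * iter m.+2 (@backdiff R) (truncpow m.+1) t).
  have d1 := @is_derive_iter_backdiff _ _ _ m.+2 (@is_derive_truncpow R m) t.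
  have d2 := is_deriveZ ((m.+2)`!%:R^-1) d1.
  apply: is_derive_eq d2 _.
  rewrite iter_backdiffZ /GRing.scale /= mulrA; congr (_ * _).
  by rewrite factS natrM invfM mulrC mulrA divff ?mul1r // pnatr_eq0.
rewrite (convolution_indicator x dH); first by rewrite /backdiff -mulrBr.
move=> t.
have ct := @continuous_iter_backdiff R (truncpow m.+1) m.+2 (@continuous_truncpow R m) t.
have cc : {for t, continuous (fun=> (m.+1)`!%:R^-1 : R)} by exact: cst_continuous.
exact: (continuousM cc ct).
Qed.

(** * The spline space on a bounded interval *)

Lemma bspline_support (R : realType) m (x : R) :
  (x < 0) || (m.+1%:R < x) -> bspline m x = 0.
Proof.
elim: m x => [|m IH] x xm /=.
  rewrite indicE mem_setE in_itv /=.
  by case: (leP 0 x) xm => //= _; case: leP.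
rewrite /convolution /Rintegral (_ : (\int[lebesgue_measure]_(t in setT) _)%E = 0%E) //.
apply: integral0_eq => t _; congr (_%:E); rewrite indicE mem_setE in_itv /=.
case: andP => [[t0 t1]|_]; last by rewrite mulr0.
rewrite mulr1 IH //; case/orP: xm => xm.
  by apply/orP; left; lra.
by apply/orP; right; rewrite -natr1 in xm; lra.
Qed.

(** The B-spline vanishes outside [0, m + 1], so on a bounded set only the
    translates from a bounded window contribute. *)
Lemma spline_sumE (R : realType) m (c : int -> R[i]) (lo : int) (L : nat) (x : R) :
  lo%:~R + m.+1%:R <= x -> x < (lo + L%:Z)%:~R ->
  \sum_(n \in [set: int]) (c n * (bspline m (x - n%:~R))%:C) =
  \sum_(i < L) c (lo + i%:Z) * (bspline m (x - (lo + i%:Z)%:~R))%:C.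
Proof.
move=> lox xhi; rewrite (fsbigE [seq lo + i%:Z | i <- iota 0 L]) /=.
- rewrite big_map -{1}[L]subn0 -/(index_iota 0 L) big_mkord.
  by apply: eq_bigl => i; rewrite in_setT.
- by rewrite map_inj_uniq ?iota_uniq // => i j /addrI[].
- by [].
move=> n _ nin; rewrite bspline_support ?mulr0 //.
case: (ltP n lo) => nlo.
  have : n%:~R <= (lo - 1)%:~R :> R by rewrite ler_int lerBrDr lezD1.
  by rewrite intrB => h; apply/orP; right; lra.
apply/orP; left; rewrite subr_lt0; apply: lt_le_trans xhi _; rewrite ler_int.
rewrite leNgt; apply/negP => nL; move/negP: nin; apply; apply/mapP.
exists `|n - lo|%N; last by rewrite gez0_abs ?subr_ge0 // subrKC.
by rewrite mem_iota /= add0n -ltz_nat gez0_abs ?subr_ge0 // ltrBlDl.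
Qed.

Lemma spline_sum_window (R : realType) m (x : R) :
  exists2 lo : int, lo%:~R + m.+1%:R <= x & x < (lo + m.+2%:Z)%:~R.
Proof.
exists (Num.floor x - m.+1%:Z); first by rewrite intrB subrK ge_floor.
by rewrite -addrA (_ : - m.+1%:Z + m.+2%:Z = 1) ?lt_succ_floor //; lia.
Qed.

Lemma spline_spaceD (R : realType) m (f g : R -> R[i]) :
  spline_space m f -> spline_space m g -> spline_space m (fun x => f x + g x).
Proof.
move=> [c fE] [d gE]; exists (fun n => c n + d n) => x.
have [lo lox xhi] := spline_sum_window m x.
rewrite fE gE !(spline_sumE _ lox xhi) -big_split /=.
by apply: eq_bigr => i _; rewrite mulrDl.
Qed.

Lemma spline_spaceZ (R : realType) m (f : R -> R[i]) (a : R[i]) :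
  spline_space m f -> spline_space m (fun x => a * f x).
Proof.
move=> [c fE]; exists (fun n => a * c n) => x.
have [lo lox xhi] := spline_sum_window m x.
rewrite fE !(spline_sumE _ lox xhi) big_distrr /=.
by apply: eq_bigr => i _; rewrite mulrA.
Qed.

Lemma spline_space_bspline (R : realType) m (k : int) :
  spline_space m (fun x : R => (bspline m (x - k%:~R))%:C).
Proof.
exists (fun n => (n == k)%:R) => x; rewrite (fsbigE [:: k]) //.
  by rewrite big_cons big_nil in_setT /= eqxx mul1r addr0.
by move=> n _; rewrite inE => /negbTE->; rewrite mul0r.
Qed.

Definition real_spline (R : realType) m (n1 n2 : int) (u : R -> R) :=
  exists2 f : R -> R[i], spline_space m f &
    forall t : R, n1%:~R <= t <= n2%:~R -> f t = (u t)%:C.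

Lemma real_splineD (R : realType) m n1 n2 (u v : R -> R) :
  real_spline m n1 n2 u -> real_spline m n1 n2 v ->
  real_spline m n1 n2 (fun x => u x + v x).
Proof.
move=> [f Wf fu] [g Wg gv]; exists (fun x => f x + g x); first exact: spline_spaceD.
by move=> t tn; rewrite fu // gv // raddfD.
Qed.

Lemma real_splineZ (R : realType) m n1 n2 a (u : R -> R) :
  real_spline m n1 n2 u -> real_spline m n1 n2 (fun x => a * u x).
Proof.
move=> [f Wf fu]; exists (fun x => a%:C * f x); first exact: spline_spaceZ.
by move=> t tn; rewrite fu // rmorphM.
Qed.

Lemma real_spline_bspline (R : realType) m n1 n2 (k : int) :
  real_spline m n1 n2 (fun x : R => bspline m (x - k%:~R)).
Proof.
by exists (fun x => (bspline m (x - k%:~R))%:C); first exact: spline_space_bspline.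
Qed.

Lemma eq_real_spline (R : realType) m n1 n2 (u v : R -> R) :
  (forall t, n1%:~R <= t <= n2%:~R -> u t = v t) ->
  real_spline m n1 n2 u -> real_spline m n1 n2 v.
Proof. by move=> uv [f Wf fu]; exists f => // t tn; rewrite -uv // fu. Qed.

Lemma real_spline0 (R : realType) m n1 n2 : real_spline m n1 n2 (fun=> 0 : R).
Proof.
apply: eq_real_spline (real_splineZ 0 (real_spline_bspline R m n1 n2 0)) => t _.
by rewrite mul0r.
Qed.

Lemma real_spline_sum (R : realType) m n1 n2 (I : Type) (r : seq I) (u : I -> R -> R) :
  (forall i, real_spline m n1 n2 (u i)) ->
  real_spline m n1 n2 (fun x => \sum_(i <- r) u i x).
Proof.
move=> Wu; elim: r => [|i r IH].
  by apply: eq_real_spline (real_spline0 R m n1 n2) => t _; rewrite big_nil.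
by apply: eq_real_spline (real_splineD (Wu i) IH) => t _; rewrite big_cons.
Qed.

Lemma iter_backdiff_truncpow0 (R : realType) m j (x : R) :
  x <= 0 -> iter j (@backdiff R) (truncpow m.+1) x = 0.
Proof.
elim: j x => [|j IH] x x0 /=; first by rewrite /truncpow max_l // expr0n.
by rewrite /backdiff !IH ?subrr //; lra.
Qed.

(** The B-spline is the [(m + 1)]-st difference of the truncated power; on an
    interval bounded above, taking differences of functions that vanish on the
    negative half-line can be undone by finite sums of translates. *)
Lemma real_spline_truncpow (R : realType) m n1 n2 (k : int) :
  real_spline m.+1 n1 n2 (fun x : R => truncpow m.+1 (x - k%:~R)).
Proof.
(* Downward induction on the number of differences, from the B-spline itself. *)
suff H d : (d <= m.+2)%N -> forall k : int, real_spline m.+1 n1 n2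
    (fun x : R => iter (m.+2 - d) (@backdiff R) (truncpow m.+1) (x - k%:~R)).
  by have := H m.+2 (leqnn _) k; rewrite subnn.
elim: d => [|d IH] dm {}k.
  have W := real_spline_bspline R m.+1 n1 n2 k.
  apply: eq_real_spline (real_splineZ ((m.+1)`!%:R) W) => t _.
  by rewrite subn0 bspline_truncpow mulrA divff ?mul1r // pnatr_eq0 -lt0n fact_gt0.
have {}IH := IH (ltnW dm); rewrite subSn // in IH.
(* With h the function of the previous level and g the one of this level, the
   recurrence g(x - k) = h(x - k) + g(x - k - 1) stops once k reaches n2, where
   g(x - k) vanishes on the whole interval. *)
suff H e : forall k : int, n2 <= k + e%:Z -> real_spline m.+1 n1 n2
    (fun x : R => iter (m.+2 - d.+1) (@backdiff R) (truncpow m.+1) (x - k%:~R)).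
  by apply: (H `|n2 - k|%N); rewrite -lerBlDl; exact: ler_norm.
elim: e => [|e IHe] {}k n2k.
  apply: eq_real_spline (real_spline0 R m.+1 n1 n2) => t /andP[_ tn2].
  rewrite iter_backdiff_truncpow0 // subr_le0 (le_trans tn2) // ler_int.
  by move: n2k; rewrite addr0.
have {}IHe : real_spline m.+1 n1 n2 (fun x : R =>
    iter (m.+2 - d.+1) (@backdiff R) (truncpow m.+1) (x - (k + 1)%:~R)).
  by apply: IHe; move: n2k; rewrite -addrA -[1]/(1%:Z) -PoszD add1n.
apply: eq_real_spline (real_splineD (IH k) IHe) => t _ /=.
by rewrite subSS /backdiff intrD opprD addrA subrK.
Qed.

Lemma coef_expXsubC (R : realType) (b : R) m i : (i <= m)%N ->
  (('X - b%:P) ^+ m)`_i = (- b) ^+ (m - i) *+ 'C(m, i).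
Proof.
move=> im; rewrite addrC exprDn coef_sum -polyCN.
rewrite (bigD1 (Ordinal (im : i < m.+1)%N)) //= coefMn -polyC_exp coefCM coefXn eqxx mulr1.
rewrite big1 ?addr0 // => j ji; rewrite coefMn -polyC_exp coefCM coefXn.
case: eqP => [ij|_]; last by rewrite mulr0 mul0rn.
by case/eqP: ji; apply/val_inj.
Qed.

(** The coefficient matrix is, up to binomial factors, a Vandermonde matrix. *)
Lemma expXsubC_span (R : realType) m (b : 'I_m.+1 -> R) (p : {poly R}) :
  injective b -> (size p <= m.+1)%N ->
  exists w : 'I_m.+1 -> R, p = \sum_l w l *: ('X - (b l)%:P) ^+ m.
Proof.
move=> bi sp.
pose A := \matrix_(l < m.+1, i < m.+1) (('X - (b l)%:P) ^+ m)`_i.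
have uA : A \in unitmx.
  rewrite -unitmx_tr -row_free_unit -kermx_eq0; apply/eqP/row_matrixP => r.
  rewrite row0; set v := row r _; have vA : v *m A^T = 0.
    by rewrite -row_mul mulmx_ker row0.
  move: v vA => v vA.
  pose q := \poly_(j < m.+1) (v 0 (inord (m - j)) *+ 'C(m, m - j)).
  have qb l : q.[- b l] = 0.
    move/matrixP: vA => /(_ 0 l); rewrite !mxE => vA.
    rewrite -[RHS]vA horner_poly (reindex_inj rev_ord_inj) /=.
    apply: eq_bigr => i _; have im : (i <= m)%N by rewrite -ltnS.
    have -> : A^T i l = (- b l) ^+ (m - i) *+ 'C(m, i).
      by rewrite [LHS]mxE [LHS]mxE coef_expXsubC.
    by rewrite subSS subKn // inord_val mulrnAl mulrnAr.
  have q0 : q = 0.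
    apply/eqP/negPn/negP => q0;
    have := @max_poly_roots _ q (map (fun l => - b l) (enum 'I_m.+1)) q0.
    rewrite size_map size_enum_ord => K; suff : (m.+1 < m.+1)%N by rewrite ltnn.
    apply: leq_trans (size_poly _ _); apply: K.
      by apply/allP => _ /mapP[l _ ->]; rewrite rootE qb.
    by rewrite map_inj_uniq ?enum_uniq // => l l' /oppr_inj/bi.
  apply/rowP => i; rewrite [RHS]mxE; have im : (i <= m)%N by rewrite -ltnS.
  move/polyP: q0 => /(_ (m - i)%N); rewrite coef_poly coef0 ltnS leq_subr subKn //.
  by rewrite inord_val => /eqP; rewrite mulrn_eq0 -leqn0 leqNgt bin_gt0 im => /eqP.
pose w := poly_rV p *m invmx A.
exists (fun l => w 0 l); apply/polyP => i; rewrite coef_sum.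
case: (ltnP i m.+1) => im; last first.
  rewrite nth_default ?(leq_trans sp) // big1 // => l _.
  rewrite coefZ nth_default ?mulr0 // size_exp_XsubC //.
have /matrixP/(_ 0 (Ordinal im)) : w *m A = poly_rV p by rewrite mulmxKV.
rewrite [in RHS]mxE /= => <-; rewrite mxE; apply: eq_bigr => l _.
by rewrite coefZ [A _ _]mxE.
Qed.

(** To the left of the interval lie infinitely many knots [k], and for these the
    truncated power coincides on the interval with the power (x - k)^(m+1). *)
Lemma real_spline_poly (R : realType) m n1 n2 (p : {poly R}) :
  (size p <= m.+2)%N -> real_spline m.+1 n1 n2 (horner p).
Proof.
move=> sp; have [|w ->] := @expXsubC_span R m.+1 (fun l => (n1 - l%:Z)%:~R) p _ sp.
  by move=> i j /intr_inj /addrI /oppr_inj [] /val_inj.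
apply: eq_real_spline (_ : real_spline m.+1 n1 n2 (fun x : R =>
  \sum_(l < m.+2) w l * truncpow m.+1 (x - (n1 - l%:Z)%:~R))) => [t /andP[tn _]|].
  rewrite horner_sum; apply: eq_bigr => l _.
  rewrite hornerZ horner_exp hornerXsubC /truncpow max_r // subr_ge0 (le_trans _ tn) //.
  by rewrite ler_int gerBl.
by apply: real_spline_sum => l; apply: real_splineZ; exact: real_spline_truncpow.
Qed.

(** [glue] is left out here so that products can be formed piece by piece. *)
Definition is_spline (R : realType) (d r M : nat) (a : R) (u : R -> R) :=
  exists2 P, spline_pieces d r M a P &
    forall k x, (k < M)%N -> a + k%:R <= x <= a + k.+1%:R -> u x = (P k).[x].

Lemma is_spline_linear (R : realType) d r M (a c : R) u v :
  is_spline d r M a u -> is_spline d r M a v ->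
  is_spline d r M a (fun x => c * u x + v x).
Proof.
move=> [P [sP dP] uP] [Q [sQ dQ] vQ]; exists (fun k => c *: P k + Q k).
  split=> k kM.
    rewrite (leq_trans (size_polyD _ _)) // geq_max sQ // andbT.
    by rewrite (leq_trans (size_scale_leq _ _)) ?sP.
  rewrite opprD addrACA -scalerBr; apply: dvdp_add; last exact: dQ.
  by rewrite -mul_polyC dvdp_mull ?dP.
by move=> k x kM kx; rewrite (uP k) // (vQ k) // hornerD hornerZ.
Qed.

Lemma is_spline_mul (R : realType) d d' r M (a : R) u v :
  is_spline d r M a u -> is_spline d' r M a v ->
  is_spline (d + d') r M a (fun x => u x * v x).
Proof.
move=> [P [sP dP] uP] [Q [sQ dQ] vQ]; exists (fun k => P k * Q k).
  split=> k kM.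
    rewrite (leq_trans (size_polyMleq _ _)) //.
    by have := sP k kM; have := sQ k kM; case: (size (P k)) (size (Q k)) => [|s] [|s'] //=; lia.
  have -> : P k.+1 * Q k.+1 - P k * Q k = P k.+1 * (Q k.+1 - Q k) + (P k.+1 - P k) * Q k.
    by rewrite mulrBr mulrBl addrA subrK.
  by apply: dvdp_add; [rewrite dvdp_mull ?dQ|rewrite dvdp_mulr ?dP].
by move=> k x kM kx; rewrite (uP k) // (vQ k) // hornerM.
Qed.

Lemma is_spline0 (R : realType) d r M (a : R) : is_spline d r M a (fun=> 0).
Proof.
exists (fun=> 0); last by move=> k x _ _; rewrite horner0.
by split=> k kM; rewrite ?size_poly0 // subr0 dvdp0.
Qed.

Lemma is_spline_truncpow (R : realType) m M (n1 k : int) :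
  is_spline m.+1 m.+1 M (n1%:~R : R) (fun x => truncpow m.+1 (x - k%:~R)).
Proof.
exists (fun j => if k <= n1 + j%:Z then ('X - k%:~R%:P) ^+ m.+1 else 0).
  split=> j _.
    by case: ifP => _; rewrite ?size_poly0 // size_exp_XsubC.
  case: (leP k (n1 + j%:Z)) => kj.
    by rewrite (le_trans kj) ?subrr ?dvdp0 // lerD2l lez_nat.
  case: ifP => kj'; last by rewrite subr0 dvdp0.
  rewrite subr0; have -> : k%:~R = n1%:~R + j.+1%:R :> R; last exact: dvdpp.
  by rewrite -[j.+1%:R]/(j.+1%:~R) -intrD; congr (_%:~R); lia.
move=> j x _ /andP[jx xj]; rewrite /truncpow; case: ifP => kj.
  rewrite horner_exp hornerXsubC max_r // subr_ge0 (le_trans _ jx) //.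
  by rewrite -[j%:R]/(j%:~R) -intrD ler_int.
rewrite horner0 max_l ?expr0n // subr_le0 (le_trans xj) //.
by rewrite -[j.+1%:R]/(j.+1%:~R) -intrD ler_int; lia.
Qed.

Lemma is_spline_bspline (R : realType) m M (n1 k : int) :
  is_spline m.+1 m.+1 M (n1%:~R : R) (fun x => bspline m.+1 (x - k%:~R)).
Proof.
have H j : forall k : int, is_spline m.+1 m.+1 M (n1%:~R : R)
    (fun x => iter j (@backdiff R) (truncpow m.+1) (x - k%:~R)).
  elim: j => [|j IH] {}k; first exact: is_spline_truncpow.
  have := is_spline_linear (-1) (IH (k + 1)) (IH k); congr is_spline.
  by apply/funext => x /=; rewrite /backdiff mulN1r addrC intrD opprD addrA.
have := is_spline_linear ((m.+1)`!%:R^-1) (H m.+2 k) (is_spline0 _ _ _ _).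
by congr is_spline; apply/funext => x; rewrite addr0 bspline_truncpow.
Qed.

Lemma is_spline_sum (R : realType) d r M (a : R) (I : Type) (s : seq I)
    (w : I -> R) (u : I -> R -> R) :
  (forall i, is_spline d r M a (u i)) ->
  is_spline d r M a (fun x => \sum_(i <- s) w i * u i x).
Proof.
move=> us; elim: s => [|i s IH].
  have := is_spline0 d r M a; congr is_spline; apply/funext => x.
  by rewrite big_nil.
have := is_spline_linear (w i) (us i) IH; congr is_spline; apply/funext => x.
by rewrite big_cons.
Qed.

(** * Sampling and determination *)

Lemma solve_of_kernel (F : fieldType) (I : finType) (N : nat)
    (b : I -> 'I_N -> F) (v : I -> F) :
  (forall w : I -> F, (forall n, \sum_i w i * b i n = 0) -> \sum_i w i * v i = 0) ->
  exists s : 'I_N -> F, forall i, v i = \sum_n b i n * s n.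
Proof.
move=> ker; pose A := \matrix_(i < #|I|, n < N) b (enum_val i) n.
pose V : 'cV_#|I| := \col_i v (enum_val i).
have /submxP[D VD] : (V^T <= A^T)%MS.
  rewrite submxE -trmx_eq0 trmx_mul trmxK; apply/eqP/row_matrixP => r.
  rewrite row0 row_mul; set w := row r _.
  have : w *m A = 0.
    rewrite -row_mul (_ : (cokermx A^T)^T *m A = 0) ?row0 //.
    by apply: trmx_inj; rewrite trmx_mul trmxK mulmx_coker trmx0.
  move: w => w wA; pose w' i := w 0 (enum_rank i).
  have sumE (f : I -> F) : \sum_i w' i * f i = \sum_j w 0 j * f (enum_val j).
    rewrite (reindex _ (onW_bij _ (@enum_val_bij I))) /=.
    by apply: eq_bigr => j _; rewrite /w' enum_valK.
  have := ker w'; rewrite sumE => kw.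
  apply/rowP => j; rewrite ord1 !mxE -[RHS]kw; last first.
    move=> n; rewrite sumE; move/rowP: wA => /(_ n); rewrite !mxE => wA; rewrite -[RHS]wA.
    by apply: eq_bigr => l _; rewrite !mxE.
  by apply: eq_bigr => l _; rewrite !mxE.
exists (fun n => D 0 n) => i; move/matrixP: VD => /(_ 0 (enum_rank i)).
rewrite !mxE enum_rankK => ->; apply: eq_bigr => n _.
by rewrite !mxE enum_rankK mulrC.
Qed.

(** The squared modulus of a function in the spline space is a combination of the
    products of two B-splines; these products are splines of degree
    [2 (m + 1)], so a combination of them that vanishes at the samples
    vanishes. *)
Lemma determined_sampling (R : realType) (m : nat) (n1 n2 : int) (N : nat)
    (x : 'I_N -> R) (M := `|n2 - n1|%N) :
  n1 < n2 -> (forall n, n1%:~R <= x n <= n2%:~R) ->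
  determined m.+1 M n1%:~R (sample_seq x) ->
  exists S : 'I_N -> R -> R[i],
    forall t : R, n1%:~R <= t <= n2%:~R -> forall f, spline_space m.+1 f ->
      `|f t| ^+ 2 = \sum_(n < N) `|f (x n)| ^+ 2 * S n t.
Proof.
move=> n12 xin det; have n2E : n2 = n1 + M%:Z.
  by rewrite /M gez0_abs ?subr_ge0 ?ltW // subrKC.
have n2R : n2%:~R = n1%:~R + M%:R :> R by rewrite n2E intrD.
(* The translates by [lo], ..., [lo + L - 1] include all those that do not vanish
   on the interval. *)
pose lo := n1 - m.+2%:Z; pose L := (M + m.+3)%N.
have lox t : n1%:~R <= t -> lo%:~R + m.+2%:R <= t :> R by rewrite /lo intrB subrK.
have xhi t : t <= n2%:~R -> t < (lo + L%:Z)%:~R :> R.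
  by move=> tn; apply: le_lt_trans tn _; rewrite ltr_int n2E /lo /L; lia.
pose b (ij : 'I_L * 'I_L) t : R :=
  bspline m.+1 (t - (lo + ij.1%:Z)%:~R) * bspline m.+1 (t - (lo + ij.2%:Z)%:~R).
have M0 : (0 < M)%N by rewrite /M absz_gt0 subr_eq0 gt_eqF.
have ex t : exists s : 'I_N -> R, n1%:~R <= t <= n2%:~R ->
    forall ij, b ij t = \sum_n b ij (x n) * s n.
  case: (boolP (n1%:~R <= t <= n2%:~R)) => tn; last by exists (fun=> 0).
  have [w wb|s sP] := @solve_of_kernel _ _ _ (fun ij n => b ij (x n)) (fun ij => b ij t).
    have [P sP PE] : is_spline (m.+1 + m.+1) m.+1 M (n1%:~R : R)
        (fun t => \sum_ij w ij * b ij t).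
      by apply: is_spline_sum => ij; apply: is_spline_mul; exact: is_spline_bspline.
    rewrite addnn in sP.
    have P0 := det P sP.
    rewrite n2R in tn; have [k kM kt] := locate_closed_piece M0 tn.
    rewrite (PE k) // P0 ?horner0 // => e /mem_sample_seq[n ->].
    have := xin n; rewrite n2R => /(locate_closed_piece M0)[l lM lx].
    by rewrite (glue_pieceE _ sP lM lx) // -PE.
  by exists s.
have [s sP] := choice ex.
exists (fun n t => (s t n)%:C) => t tn f [c fE].
have sq y : n1%:~R <= y <= n2%:~R -> `|f y| ^+ 2 =
    \sum_(ij : 'I_L * 'I_L) c (lo + ij.1%:Z) * (c (lo + ij.2%:Z))^*%C * (b ij y)%:C.
  move=> /andP[y1 y2]; rewrite sqr_normc fE (spline_sumE _ (lox _ y1) (xhi _ y2)).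
  rewrite (rmorph_sum (@conjc R)) /= big_distrlr /= pair_bigA /=; apply: eq_bigr => ij _.
  by rewrite rmorphM /= oppr0 rmorphM /= mulrACA.
rewrite sq //; under [RHS]eq_bigr => n _ do rewrite sq ?xin // big_distrl /=.
rewrite exchange_big /=; apply: eq_bigr => ij _.
rewrite (sP t tn) rmorph_sum /= big_distrr /=; apply: eq_bigr => n _.
by rewrite rmorphM /= mulrA.
Qed.

(** The real functions recovered from their samples by [S]; unlike the squared
    moduli, they form a linear space. *)
Definition reproduced (R : realType) (n1 n2 : int) (N : nat) (x : 'I_N -> R)
    (S : 'I_N -> R -> R[i]) (u : R -> R) :=
  forall t : R, n1%:~R <= t <= n2%:~R ->
    (u t)%:C = \sum_(n < N) (u (x n))%:C * S n t.

Section Reproduced.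
Context (R : realType) (m : nat) (n1 n2 : int) (N : nat) (x : 'I_N -> R).
Context (S : 'I_N -> R -> R[i]).
Context (xin : forall n, n1%:~R <= x n <= n2%:~R).
Local Notation reproduced := (reproduced n1 n2 x S).

Lemma eq_reproduced u v :
  (forall t, n1%:~R <= t <= n2%:~R -> u t = v t) -> reproduced u -> reproduced v.
Proof.
move=> uv ru t tn; rewrite -uv // ru //; apply: eq_bigr => n _.
by rewrite uv.
Qed.

Lemma reproduced_linear c u v :
  reproduced u -> reproduced v -> reproduced (fun t => c * u t + v t).
Proof.
move=> ru rv t tn; rewrite rmorphD rmorphM /= ru // rv // big_distrr /= -big_split /=.
by apply: eq_bigr => n _; rewrite rmorphD rmorphM /= mulrDl mulrA.
Qed.

Lemma reproduced0 : reproduced (fun=> 0).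
Proof. by move=> t _; rewrite big1 // => n _; rewrite mul0r. Qed.

Lemma reproduced_sum (I : Type) (s : seq I) (u : I -> R -> R) :
  (forall i, reproduced (u i)) -> reproduced (fun t => \sum_(i <- s) u i t).
Proof.
move=> ru; elim: s => [|i s IH].
  by apply: eq_reproduced reproduced0 => t _; rewrite big_nil.
apply: eq_reproduced (reproduced_linear 1 (ru i) IH) => t _.
by rewrite mul1r big_cons.
Qed.

Context (HS : forall f : R -> R[i], spline_space m.+1 f ->
  forall t : R, n1%:~R <= t <= n2%:~R ->
  `|f t| ^+ 2 = \sum_(n < N) `|f (x n)| ^+ 2 * S n t).

(** Polarization: products of two real splines are combinations of squares. *)
Lemma reproduced_mul u v :
  real_spline m.+1 n1 n2 u -> real_spline m.+1 n1 n2 v ->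
  reproduced (fun t => u t * v t).
Proof.
have sq w : real_spline m.+1 n1 n2 w -> reproduced (fun t => w t ^+ 2).
  move=> [f Wf fw].
  have fE t : n1%:~R <= t <= n2%:~R -> `|f t| ^+ 2 = (w t ^+ 2)%:C.
    by move=> tn; rewrite fw // sqr_normc conjc_real -rmorphM expr2.
  move=> t tn; rewrite -fE // HS //; apply: eq_bigr => n _.
  by rewrite fE.
move=> Wu Wv; have r1 := sq _ (real_splineD Wu Wv).
have r2 := sq _ (real_splineD Wu (real_splineZ (-1) Wv)).
have r3 := reproduced_linear (-1) r2 r1.
apply: eq_reproduced (reproduced_linear (4^-1) r3 reproduced0) => t _.
by field.
Qed.

(** Splitting off x^(m+1) writes a polynomial of degree at most [2 (m + 1)] with
    products of polynomials of degree at most [m + 1]. *)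
Lemma reproduced_poly (p : {poly R}) :
  (size p <= (m.+1).*2.+1)%N -> reproduced (horner p).
Proof.
move=> sp; have W1 : real_spline m.+1 n1 n2 (horner (1 : {poly R})).
  by apply: real_spline_poly; rewrite size_poly1.
have WX : real_spline m.+1 n1 n2 (horner ('X^(m.+1) : {poly R})).
  by apply: real_spline_poly; rewrite size_polyXn.
have Wt : real_spline m.+1 n1 n2 (horner (take_poly m.+1 p)).
  by apply: real_spline_poly; apply: leq_trans (size_take_poly _ _) _.
have Wd : real_spline m.+1 n1 n2 (horner (drop_poly m.+1 p)).
  by apply: real_spline_poly; rewrite size_drop_poly; lia.
have := reproduced_linear 1 (reproduced_mul Wt W1) (reproduced_mul Wd WX).
apply: eq_reproduced => t _; rewrite -[in RHS](poly_take_drop m.+1 p).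
by rewrite hornerD hornerM hornerC mulr1 mul1r.
Qed.

Lemma reproduced_cut_poly (k : int) (Q : {poly R}) :
  (size Q <= (m.+1).*2.+1)%N -> ('X - k%:~R%:P) ^+ m.+1 %| Q ->
  reproduced (cut_poly k%:~R Q).
Proof.
move=> sQ /dvdpP[q QE].
have Wq : real_spline m.+1 n1 n2 (horner q).
  apply: real_spline_poly; have [->|q0] := eqVneq q 0; first by rewrite size_poly0.
  move: sQ; rewrite QE size_Mmonic ?monic_exp ?monicXsubC // size_exp_XsubC; lia.
apply: eq_reproduced (reproduced_mul Wq (real_spline_truncpow R m n1 n2 k)) => t _.
rewrite QE /cut_poly /truncpow hornerM horner_exp hornerXsubC; case: ltP => tk.
  by rewrite max_r // subr_ge0 ltW.
by rewrite max_l ?subr_le0 // expr0n /= mulr0.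
Qed.

Lemma reproduced_glue M P :
  spline_pieces (m.+1).*2 m.+1 M (n1%:~R : R) P -> (0 < M)%N ->
  reproduced (glue P M n1%:~R).
Proof.
move=> [sP dP] M0; have rc : reproduced (fun t : R =>
    \sum_(k < M.-1) cut_poly (n1%:~R + k.+1%:R) (P k.+1 - P k) t).
  apply: reproduced_sum => k; have kM : (k.+1 < M)%N by have := ltn_ord k; lia.
  have <- : (n1 + k.+1%:Z)%:~R = n1%:~R + k.+1%:R :> R by rewrite intrD.
  apply: reproduced_cut_poly; last by rewrite intrD; exact: dP.
  rewrite (leq_trans (size_polyD _ _)) // size_polyN geq_max !sP //.
  exact: ltnW.
apply: eq_reproduced (reproduced_linear 1 (reproduced_poly (sP 0%N M0)) rc) => t _.
by rewrite mul1r.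
Qed.

End Reproduced.

Lemma sampling_determined (R : realType) (m : nat) (n1 n2 : int) (N : nat)
    (x : 'I_N -> R) (S : 'I_N -> R -> R[i]) (M := `|n2 - n1|%N) :
  n1 < n2 -> (forall n, n1%:~R <= x n <= n2%:~R) ->
  (forall f : R -> R[i], spline_space m.+1 f ->
    forall t : R, n1%:~R <= t <= n2%:~R ->
    `|f t| ^+ 2 = \sum_(n < N) `|f (x n)| ^+ 2 * S n t) ->
  determined m.+1 M n1%:~R (sample_seq x).
Proof.
move=> n12 xin HS P sP PE k kM.
have n2E : n2 = n1 + M%:Z by rewrite /M gez0_abs ?subr_ge0 ?ltW // subrKC.
have n2R : n2%:~R = n1%:~R + M%:R :> R by rewrite n2E intrD.
have g0 t : n1%:~R <= t <= n2%:~R -> glue P M n1%:~R t = 0.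
  move=> tn; have := reproduced_glue xin HS sP (leq_ltn_trans (leq0n k) kM) tn.
  rewrite big1 => [[]//|n _].
  by rewrite PE ?mul0r //; exact: sample_in_seq.
apply/eqP/negPn/negP => Pk0.
have [|z [z1 z2 /negP[]]] := @poly_nonroot_between _ _
  (n1%:~R + k%:R) (n1%:~R + k.+1%:R) Pk0; first by rewrite ltrD2l ltr_nat.
rewrite -(glue_pieceE (ltn0Sn m) sP kM) ?(ltW z1) ?(ltW z2) // g0 //.
rewrite n2R (le_trans _ (ltW z1)) ?lerDl //= (le_trans (ltW z2)) //.
by rewrite lerD2l ler_nat.
Qed.

Theorem theorem1p3 (R : realType) (m : nat) (n1 n2 : int) (N : nat)
    (x : 'I_N -> R) (m_ge1 : (1 <= m)%N) (n1_lt_n2 : n1 < n2)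
    (x_inj : injective x) (x_in : forall n, x n \in `[n1%:~R, n2%:~R]) :
  (linear_sampling_sequence n1%:~R n2%:~R
     (sqnorm_restrictions (spline_space m) n1%:~R n2%:~R) x <->
   sampling_conditions m n1 n2 x) /\
  (sampling_conditions m n1 n2 x ->
   exists S : 'I_N -> R -> R[i],
     forall t : R, t \in `[n1%:~R, n2%:~R] -> forall f, spline_space m f ->
       `|f t| ^+ 2 = \sum_(n < N) `|f (x n)| ^+ 2 * S n t).
Proof.
case: m m_ge1 => // m _.
have xin n : n1%:~R <= x n <= n2%:~R by have := x_in n; rewrite in_itv.
have n2E : n2 = n1 + `|n2 - n1|%N%:Z.
  by rewrite gez0_abs ?subr_ge0 ?ltW // subrKC.
have ein e : e \in sample_seq x ->
    n1%:~R <= e <= n1%:~R + `|n2 - n1|%N%:R.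
  move=> /mem_sample_seq[n ->].
  by rewrite -[_%:R]/(_%:Z%:~R) -intrD -n2E; exact: xin.
have exS : sampling_conditions m.+1 n1 n2 x -> exists S : 'I_N -> R -> R[i],
    forall t : R, t \in `[n1%:~R, n2%:~R] -> forall f, spline_space m.+1 f ->
      `|f t| ^+ 2 = \sum_(n < N) `|f (x n)| ^+ 2 * S n t.
  move=> /(interlaced_sampling_conditions m.+1 n1_lt_n2 x_inj x_in) lace.
  have [|S HS] := @determined_sampling R m n1 n2 N x n1_lt_n2 xin.
    exact: interlaced_determined (sample_seq_sorted x_inj) ein lace.
  by exists S => t; rewrite in_itv; exact: HS.
split=> //; split=> [[_ [S HS]]|conds].
  apply/(interlaced_sampling_conditions m.+1 n1_lt_n2 x_inj x_in).
  apply: determined_interlaced => //; apply: (@sampling_determined _ _ _ _ _ _ S) => //.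
  move=> f Wf t tn.
  have tin : t \in `[n1%:~R, n2%:~R] by rewrite in_itv.
  have Hf : sqnorm_restrictions (spline_space m.+1) n1%:~R n2%:~R
      (patch (fun=> 0) `[n1%:~R, n2%:~R] (fun x => `|f x| ^+ 2)) by exists f.
  have := HS _ Hf t tin; rewrite /patch mem_setE tin => ->.
  by apply: eq_bigr => n _; rewrite x_in.
have [S HS] := exS conds; split=> //; exists S => _ [f Wf <-] t tin.
rewrite /patch mem_setE tin (HS t tin f Wf); apply: eq_bigr => n _.
by rewrite x_in.
Qed.
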